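(* Let $R$ be a residue finite principal ideal domain and let $n$ be a positive integer. Then, by the change of variables $t=\exp(-s)$ from $t$ to $s$, the growth function $P_{\mathrm{M}(n,R)^\times,\deg}(t)$ and the skew-growth function $N_{\mathrm{M}(n,R)^\times,\deg}(t)$ are absolutely convergent on some right half $s$-plane and are given as analytic functions as follows: $$\textbf{1)}\quad P_{\mathrm{M}(n,R)^\times,\deg}(\exp(-s))=\zeta_R(s)\,\zeta_R(s-1)\cdots\zeta_R(s-n+1),$$ $$\textbf{2)}\quad N_{\mathrm{M}(n,R)^\times,\deg}(\exp(-s))=\prod_{p\in\{\text{primes of }R\}/R^\times}(1-N(p)^{-s})(1-N(p)^{-s+1})\cdots(1-N(p)^{-s+n-1}),$$ where $\zeta_R(s):=\sum_{a\in(R\setminus\{0\})/R^\times}N(a)^{-s}$ is the Dedekind zeta-function, which is well known to be absolutely convergent on a region $\Re(s)>\sigma_a$ for some $\sigma_a$ and to have the Euler product expression $\prod_{p\in\{\text{primes of }R\}/R^\times}(1-N(p)^{-s})^{-1}$ on the same domain.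
   Context: A domain $R$ is residue finite if $\#(R/mR)<\infty$ for all $m\in R\setminus\{0\}$. The absolute norm is $N:R\setminus\{0\}\to\mathbb Z_{\ge1}$, $N(m)=\#(R/mR)$. $R^\times$ is the unit group of $R$; primes are taken up to units. $\mathrm{M}(n,R)^\times=\{X\in\mathrm{M}(n,R)\mid\det(X)\neq0\}$, a monoid under matrix multiplication. For $X,Y\in\mathrm{M}(n,R)^\times$, $X\mid_lY$ means $XZ=Y$ for some $Z\in\mathrm{M}(n,R)^\times$, and $X\sim_lY$ means $X\mid_lY$ and $Y\mid_lX$ (equivalently $Y\in X\,\mathrm{GL}(n,R)$); $[X]$ is the $\sim_l$-class of $X$. An element $X\notin\mathrm{GL}(n,R)$ is irreducible if $X=YZ$ with $Y,Z\in\mathrm{M}(n,R)^\times$ implies $Y\in\mathrm{GL}(n,R)$ or $Z\in\mathrm{GL}(n,R)$; $I_0$ is the set of $\sim_l$-classes of irreducible elements. A least common multiple of a set $J$ (of elements, or of classes) is an element $L$ with $X\mid_lL$ for all $X$ (with $X$ or $[X]$ in $J$) such that $L\mid_lL'$ for every other $L'$ with this property; for every finite $J$ it exists and its $\sim_l$-class, denoted $\mathrm{LCM}(J)$, is unique ($\mathrm{LCM}(\emptyset)=[1_n]$). The degree map is $\deg=\log\circ N\circ\det:\mathrm{M}(n,R)^\times\to\mathbb R_{\ge0}$; it depends only on $\sim_l$-classes, and for every $r$ there are only finitely many classes of degree $\le r$. The growth and skew-growth functions are the formal Dirichlet series $$P_{\mathrm{M}(n,R)^\times,\deg}(t)=\sum_{[X]\in\mathrm{M}(n,R)^\times/\mathrm{GL}(n,R)}t^{\deg([X])},\qquad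 N_{\mathrm{M}(n,R)^\times,\deg}(t)=\sum_{J\text{ finite subset of }I_0}(-1)^{\#J}\,t^{\deg(\mathrm{LCM}(J))}.$$ As formal Dirichlet series, terms with the same exponent are collected, so each is a series $\sum_r c_r t^r$ with $t^{r}=\exp(-sr)$.
   Formalization: Absolute convergence of the zeta-function of R on Re(s) > sigma_a for some sigma_a, called well known in the statement, is assumed as a hypothesis, since it fails for some residue finite principal ideal domains; it is necessary for the conclusion. *)

(* Defs.v *)
From HB Require Import structures.
From mathcomp Require Import all_boot all_order all_algebra.
From mathcomp Require Import finmap complex.
From mathcomp Require Import all_classical all_reals all_analysis.

Set Implicit Arguments.
Unset Strict Implicit.
Unset Printing Implicit Defensive.

Import Order.TTheory GRing.Theory Num.Theory.
Import numFieldNormedType.Exports.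

Local Open Scope classical_set_scope.
Local Open Scope ring_scope.
Local Open Scope complex_scope.

Section Arithmetic.
Variable R : idomainType.

Definition rdvd (a b : R) : Prop := exists c, b = a * c.

Definition is_ideal (I : set R) : Prop :=
  I 0 /\ forall a u v, I u -> I v -> I (a * u + v).

Definition is_PID : Prop :=
  forall I : set R, is_ideal I -> exists a, I = [set x | rdvd a x].

(* The quotient R/mR, as the set of the cosets x + mR. *)
Definition residues (m : R) : set (set R) :=
  range (fun x => [set y | rdvd m (y - x)]).

Definition residue_finite : Prop :=
  forall m : R, m != 0 -> finite_set (residues m).

(* N(m) = #(R/mR); fset_set sends an infinite set to fset0, so the value is
   meaningful when R/mR is finite. *)
Definition absnorm (m : R) : nat := #|` fset_set (residues m)|%fset.

Definition prime_elt (p : R) : Prop :=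
  [/\ p != 0, p \isn't a GRing.unit
    & forall a b, rdvd p (a * b) -> rdvd p a \/ rdvd p b].

(* The class a R^* of a, as a subset of R. *)
Definition assoc_class (a : R) : set R :=
  [set a * u | u in [set u | u \is a GRing.unit]].

Definition nonzero_classes : set (set R) :=
  [set assoc_class a | a in [set a | a != 0]].

Definition prime_classes : set (set R) :=
  [set assoc_class p | p in prime_elt].

(* Norm of a class, computed on a chosen representative; associates have the
   same norm. *)
Definition class_norm (c : set R) : nat := absnorm (xget 0 c).

End Arithmetic.

Section MatrixMonoid.
Variables (R : idomainType) (n : nat).
Implicit Types X Y Z L : 'M[R]_n.

(* The monoid M(n,R)^x of matrices with nonzero determinant; GL(n,R) is
   unitmx. *)
Definition nonsing : set 'M[R]_n := [set X | \det X != 0].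

Definition ldvd X Y : Prop := exists2 Z, nonsing Z & X *m Z = Y.

Definition lassoc X Y : Prop := ldvd X Y /\ ldvd Y X.

Definition lclass X : set 'M[R]_n := [set Y | lassoc X Y].

(* M(n,R)^x / GL(n,R) *)
Definition lclasses : set (set 'M[R]_n) := [set lclass X | X in nonsing].

Definition irreducible_mx X : Prop :=
  [/\ nonsing X, X \notin unitmx
    & forall Y Z, nonsing Y -> nonsing Z -> X = Y *m Z ->
        Y \in unitmx \/ Z \in unitmx].

Definition I0 : set (set 'M[R]_n) := [set lclass X | X in irreducible_mx].

Definition common_multiple (J : set (set 'M[R]_n)) L : Prop :=
  nonsing L /\ forall X, nonsing X -> J (lclass X) -> ldvd X L.

(* The set of all least common multiples of J: it is one class for ~_l, the
   class written LCM(J). *)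
Definition LCM (J : set (set 'M[R]_n)) : set 'M[R]_n :=
  [set L | common_multiple J L /\
           forall L', common_multiple J L' -> ldvd L L'].

End MatrixMonoid.

Section Convergence.
Variable K : realType.

Section Families.
Variables (I : choiceType) (D : set I).

Definition totally : set_system {fset I} :=
  filter_from setT (fun A => [set B | (A `<=` B)%fset]).

Definition abs_convergent (f : I -> K[i]) : Prop :=
  summable D (fun i => (complex.Re `|f i|)%:E).

(* Sum of f over D: limit of the sums over the finite subsets of D, ordered by
   inclusion. *)
Definition sum_over (f : I -> K[i]) : K[i] :=
  lim ((fun A : {fset I} => (\sum_(i <- A | i \in D) f i : K[i]^o)) @ totally).

(* The product of f over D converges unconditionally to l. *)
Definition has_prod (f : I -> K[i]) (l : K[i]) : Prop :=
  (fun A : {fset I} => (\prod_(i <- A | i \in D) f i : K[i]^o)) @ totally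
    --> (l : K[i]^o).

End Families.

Definition cexp (z : K[i]) : K[i] :=
  (expR (complex.Re z))%:C * (cos (complex.Im z) +i* sin (complex.Im z)).

(* N ^ s, for N > 0 *)
Definition npow (N : nat) (s : K[i]) : K[i] := cexp (s * (ln (N%:R : K))%:C).

(* Term of exponent r of \sum_r c r * t ^ r at t = exp (- s). The exponents are
   arbitrary reals and the terms with the same exponent are collected in c r,
   so the series is summed over r in K. *)
Definition dirichlet_term (c : K -> K[i]) (s : K[i]) (r : K) : K[i] :=
  c r * cexp (- s * r%:C).

Definition dirichlet (c : K -> K[i]) (s : K[i]) : K[i] :=
  sum_over setT (dirichlet_term c s).

Section Zeta.
Variable R : idomainType.

Definition zeta_term (s : K[i]) (c : set R) : K[i] :=
  npow (class_norm c) (- s).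

Definition zeta (s : K[i]) : K[i] :=
  sum_over (@nonzero_classes R) (zeta_term s).

End Zeta.

Section Growth.
Variables (R : idomainType) (n : nat).

Definition mxdeg (X : 'M[R]_n) : K := ln (absnorm (\det X))%:R.

(* Degree of a class, computed on a chosen representative. *)
Definition class_deg (c : set 'M[R]_n) : K := mxdeg (xget 1%:M c).

(* The sets of classes and of J's below are finite for each r (over a residue
   finite PID), which is what fset_set and the sum over a set require. *)
Definition growth_coef (r : K) : nat :=
  #|` fset_set [set c | @lclasses R n c /\ class_deg c = r]|%fset.

Definition skew_growth_coef (r : K) : int :=
  \sum_(J \in [set J : {fset set 'M[R]_n} |
                 [set` J] `<=` @I0 R n /\ class_deg (LCM [set` J]) = r])
     ((-1) ^+ #|` J|%fset : int).

End Growth.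
End Convergence.

(* The coefficients c r of t ^ r in the growth and the skew-growth series. *)
Definition Pcoef (K : realType) (R : idomainType) (n : nat) (r : K) : K[i] :=
  (growth_coef R n r)%:R.

Definition Ncoef (K : realType) (R : idomainType) (n : nat) (r : K) : K[i] :=
  (skew_growth_coef R n r)%:~R.

(* Main.v *)
Require Import Defs.
From HB Require Import structures.
From mathcomp Require Import all_boot all_order all_algebra.
From mathcomp Require Import finmap complex.
From mathcomp Require Import all_classical all_reals all_analysis.
From mathcomp Require Import ring lra zify.
Import Order.TTheory GRing.Theory Num.Theory.
Import numFieldNormedType.Exports.
Local Open Scope classical_set_scope.
Local Open Scope ring_scope.
Local Open Scope complex_scope.
Set Implicit Arguments.
Unset Strict Implicit.
Unset Printing Implicit Defensive.

(** A class of M(n,R)^x is the lattice X R^n spanned by the columns of any of its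
    members X, and its norm is N(det X).

    Growth.  By column operations a nonsingular matrix of size 1 + n becomes
    block triangular, with an entry d in the corner, a row w beside it and a
    nonsingular X' of size n below ([triangularize]).  The classes of d and X'
    are determined by the lattice, and w is determined exactly modulo d
    ([tri_lassoc]).  So N(d)^n lattices lie over a pair of classes, and the growth
    series in size 1 + n is zeta(s - n) times the one in size n
    ([growth_has_sum]).

    Skew-growth.  Right ideals of M(n,R) that contain a nonsingular matrix are
    principal ([principal_right_ideal]), so least common multiples exist and
    LCM(J) divides Z exactly when every member of J does.  Counting the pairs
    (J, Z) with LCM(J) dividing Z and N(Z) = m, with the sign (-1)^#J, in two
    ways gives, for the coefficients b of the skew-growth and a of the growth
    series, that the sum of b(d) a(m/d) over the divisors d of m is 1 for m = 1
    and 0 otherwise ([duality]): for a fixed Z the signed sum runs over all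
    subsets of the set of irreducible divisors of Z, and vanishes unless that set
    is empty, that is, unless Z is invertible.  Hence the two series are inverse
    to each other.  The inverse converges absolutely as soon as the growth series
    without its constant term is bounded by 1/2 ([inverse_bound]), which holds far
    enough to the right ([skew_term_abs]).

    Euler products.  Multiplying zeta(s) by 1 - N(p)^(-s) removes the classes
    divisible by p ([euler_factor]), and what remains after sufficiently many
    primes is close to the term 1 of the unit class ([euler_limit]).  So zeta does
    not vanish where it converges absolutely, and both it and its inverse are
    unconditional products ([zeta_euler]); the product for the skew-growth series is then the product of
    the inverses of zeta(s - i).

    Both series are holomorphic because a Dirichlet series may be differentiated
    term by term inside its half-plane of absolute convergence
    ([dirichlet_derivable]). *)

(** * Residues, norms and prime divisors *)

Section Arith.
Variable R : idomainType.
Implicit Types (a b m x y z u : R).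

Lemma rdvd_mulr a b : rdvd a (a * b).
Proof. by exists b. Qed.

Lemma rdvdD m a b : rdvd m a -> rdvd m b -> rdvd m (a + b).
Proof. by move=> [c ->] [d ->]; exists (c + d); rewrite mulrDr. Qed.

Lemma rdvdN m a : rdvd m a -> rdvd m (- a).
Proof. by move=> [c ->]; exists (- c); rewrite mulrN. Qed.

Lemma rdvdMl m a b : rdvd m a -> rdvd m (a * b).
Proof. by move=> [c ->]; exists (c * b); rewrite mulrA. Qed.

Lemma rdvd_unit a : rdvd a 1 -> a \is a GRing.unit.
Proof. by move=> [c h]; apply/unitrPr; exists c. Qed.

Section PID.
Hypothesis R_pid : is_PID R.

(** The ideal generated by a and b is principal. *)
Lemma bezout a b : exists g x y a' b',
  [/\ a = g * a', b = g * b' & g = x * a + y * b].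
Proof.
have [|g hg] := R_pid (I := [set z | exists x y, z = x * a + y * b]).
  split; first by exists 0, 0; rewrite !mul0r addr0.
  move=> c _ _ [x [y ->]] [x' [y' ->]]; exists (c * x + x'), (c * y + y').
  by ring.
have [a' ha] : rdvd g a.
  by have : [set x | rdvd g x] a by rewrite -hg; exists 1, 0; ring.
have [b' hb] : rdvd g b.
  by have : [set x | rdvd g x] b by rewrite -hg; exists 0, 1; ring.
have [x [y hxy]] : exists x y, g = x * a + y * b.
  by have : [set x | rdvd g x] g by [exists 1; rewrite mulr1]; rewrite -hg.
by exists g, x, y, a', b'.
Qed.

End PID.

(** ** Complete residue systems and the absolute norm *)

(** Finite lists of representatives replace the set of cosets when residues are
    counted: they can be multiplied ([absnormM]) and used as entries of matrices. *)
Definition res_system m (s : seq R) :=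
  [/\ uniq s, forall x, exists2 r, r \in s & rdvd m (x - r)
    & {in s &, forall r r', rdvd m (r - r') -> r = r'}].

Definition coset_of m x : set R := [set y | rdvd m (y - x)].

Lemma coset_ofP m x y : coset_of m x = coset_of m y <-> rdvd m (x - y).
Proof.
split=> [h|h].
  have : coset_of m x x by exists 0; rewrite subrr mulr0.
  by rewrite h.
apply/seteqP; split=> z hz; rewrite /coset_of /=.
  by rewrite -(subrKA x) ; apply: rdvdD.
by rewrite -(subrKA y); apply: rdvdD => //; rewrite -opprB; apply: rdvdN.
Qed.

Lemma res_system_norm m s : res_system m s -> absnorm m = size s.
Proof.
move=> [us cov inc]; rewrite /absnorm.
have -> : residues m = [set` [fset c in map (coset_of m) s]%fset].
  apply/seteqP; split=> [_ [x _ <-]|c] /=.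
    have [r rs xr] := cov x; rewrite inE; apply/mapP; exists r => //.
    exact/coset_ofP.
  by rewrite inE => /mapP[r _ ->]; exists r.
rewrite set_fsetK card_fseq undup_id ?size_map // map_inj_in_uniq // => x y xs ys.
by move=> /coset_ofP /inc; apply.
Qed.

Lemma absnorm_assoc a u : u \is a GRing.unit -> absnorm (a * u) = absnorm a.
Proof.
move=> uu; rewrite /absnorm; have E x : rdvd (a * u) x = rdvd a x.
  apply/propext; split=> [[c ->]|[c ->]]; first by exists (u * c); rewrite mulrA.
  by exists (u^-1 * c); rewrite -mulrA (mulrA u) mulrV // mul1r.
suff -> : residues (a * u) = residues a by [].
by apply/seteqP; split=> _ [x _ <-]; exists x => //; apply/seteqP; split=> y /=; rewrite E.
Qed.

Lemma absnorm1 : absnorm (1 : R) = 1%N.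
Proof.
rewrite (@res_system_norm _ [:: 0]) //; split=> // [x|].
  by exists 0; rewrite ?inE // subr0; exists x; rewrite mul1r.
by move=> x y; rewrite !inE => /eqP -> /eqP ->.
Qed.

Section Finite.
Hypothesis R_fin : residue_finite R.

Lemma res_system_exists m : m != 0 -> exists s, res_system m s.
Proof.
move=> /R_fin fin; exists [seq xget 0 c | c <- fset_set (residues m)].
have key c : c \in fset_set (residues m) -> coset_of m (xget 0 c) = c.
  rewrite in_fset_set // in_setE => -[x _ <-].
  apply/coset_ofP; case: xgetP => [y _ //|/(_ x)[]].
  by exists 0; rewrite subrr mulr0.
split.
- rewrite map_inj_in_uniq ?fset_uniq // => c d cs ds h.
  by rewrite -(key c) // -(key d) // h.
- move=> x; exists (xget 0 (coset_of m x)).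
    by apply/map_f; rewrite in_fset_set // in_setE; exists x.
  apply/coset_ofP; rewrite key // in_fset_set // in_setE; by exists x.
- move=> _ _ /mapP[c cs ->] /mapP[d ds ->] /coset_ofP.
  by rewrite !key // => ->.
Qed.

(** If x and y run over representatives modulo a and b, then x + a y runs over
    representatives modulo a b. *)
Lemma absnormM a b : a != 0 -> b != 0 -> absnorm (a * b) = (absnorm a * absnorm b)%N.
Proof.
move=> a0 b0; have [s hs] := res_system_exists a0; have [t ht] := res_system_exists b0.
rewrite (res_system_norm hs) (res_system_norm ht).
move: hs ht => [us covs incs] [ut covt inct].
have inj x x' y y' : x \in s -> x' \in s -> y \in t -> y' \in t ->
    rdvd (a * b) ((x + a * y) - (x' + a * y')) -> x = x' /\ y = y'.
  move=> xs xs' yt yt' [c hc].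
  have xx : x = x'.
    apply: incs => //; exists (b * c + y' - y).
    by rewrite mulrBr mulrDr mulrA -hc; ring.
  split=> //; apply: inct => //; exists c.
  by apply: (mulfI a0); rewrite mulrA -hc xx; ring.
rewrite (@res_system_norm _ [seq x + a * y | x <- s, y <- t]) ?size_allpairs //.
split.
- apply: allpairs_uniq => // -[x y] [x' y'] /allpairsP[[x1 y1] /= [xs yt [-> ->]]].
  move=> /allpairsP[[x2 y2] /= [xs' yt' [-> ->]]] h.
  have [|-> -> //] := inj _ _ _ _ xs xs' yt yt'.
  by exists 0; rewrite h subrr mulr0.
- move=> z; have [x xs [c hc]] := covs z; have [y yt [d hd]] := covt c.
  exists (x + a * y); first by apply/allpairsP; exists (x, y).
  exists d; rewrite -mulrA -hd mulrBr -hc; ring.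
- move=> _ _ /allpairsP[[x y] /= [xs yt ->]] /allpairsP[[x' y'] /= [xs' yt' ->]] h.
  by have [-> ->] := inj _ _ _ _ xs xs' yt yt' h.
Qed.

Lemma absnorm_gt0 m : m != 0 -> (0 < absnorm m)%N.
Proof.
move=> /res_system_exists[s hs]; rewrite (res_system_norm hs).
by case: hs => _ /(_ 0)[r rs _] _; case: s rs.
Qed.

(** With a single residue class, 0 and 1 are congruent modulo m. *)
Lemma absnorm_eq1 m : m != 0 -> absnorm m = 1%N -> m \is a GRing.unit.
Proof.
move=> /res_system_exists[s hs]; rewrite (res_system_norm hs).
case: hs => _ cov _; case: s cov => [|r [|]] //= cov _.
have [r1 h1 d1] := cov 1; have [r0 h0 d0] := cov 0.
move: h0 h1 d0 d1; rewrite !inE => /eqP -> /eqP -> d0 d1.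
apply: rdvd_unit; rewrite -(subr0 1) -(subrKA r); apply: rdvdD => //.
by rewrite -opprB; apply: rdvdN.
Qed.

Lemma absnorm_unit m : m \is a GRing.unit -> absnorm m = 1%N.
Proof. by move=> mu; rewrite -(mul1r m) absnorm_assoc // absnorm1. Qed.

Lemma absnorm_gt1 m : m != 0 -> m \isn't a GRing.unit -> (1 < absnorm m)%N.
Proof.
move=> m0 mu; rewrite ltn_neqAle absnorm_gt0 // andbT eq_sym.
by apply: contra mu => /eqP; exact: absnorm_eq1.
Qed.

Hypothesis R_pid : is_PID R.

(** A nonunit without proper factorisation is prime, by Bezout; and both factors of a
    proper factorisation have smaller norm, so the search for one ends. *)
Lemma prime_divisor a : a != 0 -> a \isn't a GRing.unit ->
  exists2 p, prime_elt p & rdvd p a.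
Proof.
have [k] := ubnP (absnorm a); elim: k a => // k IH a ak a0 au.
have [[b [c [ab bu cu]]]|noF] := pselect (exists b c, [/\ a = b * c,
    b \isn't a GRing.unit & c \isn't a GRing.unit]).
  have [b0 c0] : b != 0 /\ c != 0.
    by move: a0; rewrite ab mulf_eq0 negb_or => /andP.
  have [||//|p pp pb] := IH b.
  - move: ak; rewrite ab absnormM // => ak.
    have := absnorm_gt1 c0 cu; have := absnorm_gt0 b0; nia.
  - by [].
  by exists p => //; rewrite ab; apply: rdvdMl.
exists a; last by exists 1; rewrite mulr1.
split=> // x y axy.
have [g [u [v [a' [x' [ha hx hg]]]]]] := bezout R_pid a x.
have [gu|gu] := boolP (g \is a GRing.unit).
  right; have -> : y = g^-1 * (u * a * y + v * (x * y)).
    by rewrite mulrA -mulrDl -hg mulKr.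
  rewrite mulrC; apply: rdvdMl; apply: rdvdD; last by rewrite mulrC; apply: rdvdMl.
  by rewrite (mulrC u) -mulrA; apply: rdvdMl; exists 1; rewrite mulr1.
have a'u : a' \is a GRing.unit.
  by apply/negPn/negP => a'u; apply: noF; exists g, a'.
left; exists (a'^-1 * x'); rewrite hx ha -mulrA (mulrA a') mulrV // mul1r //.
Qed.

End Finite.

(** ** Classes of associates *)

Lemma assoc_classP a b :
  assoc_class a = assoc_class b <-> exists2 u, u \is a GRing.unit & b = a * u.
Proof.
split=> [h|[u uu ->]].
  have : assoc_class b b by exists 1; rewrite /= ?unitr1 ?mulr1.
  by rewrite -h => -[u uu <-]; exists u.
apply/seteqP; split=> _ [v vu <-].
  by exists (u^-1 * v); rewrite /= ?unitrM ?unitrV ?uu // -mulrA (mulrA u) mulrV // mul1r.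
by exists (u * v); rewrite /= ?unitrM ?uu // mulrA.
Qed.

Lemma assoc_rep a : exists2 u, u \is a GRing.unit & xget 0 (assoc_class a) = a * u.
Proof.
case: xgetP => [_ _ [u uu <-]|/(_ a)[]]; first by exists u.
by exists 1; rewrite /= ?unitr1 ?mulr1.
Qed.

Lemma class_norm_assoc a : class_norm (assoc_class a) = absnorm a.
Proof. by rewrite /class_norm; have [u uu ->] := assoc_rep a; rewrite absnorm_assoc. Qed.

End Arith.

(** * Lattices in R^n: column reduction and principal right ideals *)

Section Matrices.
Variable R : idomainType.
Hypothesis R_pid : is_PID R.
Hypothesis R_fin : residue_finite R.

Lemma nonsingM n (X Y : 'M[R]_n) : nonsing (X *m Y) <-> nonsing X /\ nonsing Y.
Proof.
by rewrite /nonsing /= det_mulmx mulf_eq0 negb_or; split=> [/andP|[-> ->]].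
Qed.

Lemma nonsing_unit n (U : 'M[R]_n) : U \in unitmx -> nonsing U.
Proof. by rewrite unitmxE /nonsing /=; apply: contraTneq => ->; rewrite unitr0. Qed.

Lemma nonsing1 n : nonsing (1%:M : 'M[R]_n).
Proof. exact/nonsing_unit/unitmx1. Qed.

(** Multiplying by the adjugate turns X into the scalar det X, which can be
    cancelled. *)
Lemma nonsing_inj n m (X : 'M[R]_n) (A B : 'M[R]_(n, m)) :
  nonsing X -> X *m A = X *m B -> A = B.
Proof.
move=> X0 /(congr1 (mulmx (\adj X))); rewrite !mulmxA mul_adj_mx !mul_scalar_mx => h.
apply/matrixP => i j; have /matrixP/(_ i j) := h; rewrite !mxE.
exact: (mulfI X0).
Qed.

Lemma ldvdP n (X Y : 'M[R]_n) : nonsing Y -> (ldvd X Y <-> exists Z, Y = X *m Z).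
Proof.
move=> Y0; split=> [[Z _ <-]|[Z hZ]]; first by exists Z.
by exists Z => //; move: Y0; rewrite hZ => /nonsingM[].
Qed.

Lemma ldvd_mul n (X Y : 'M[R]_n) : nonsing Y -> ldvd X (X *m Y).
Proof. by exists Y. Qed.

Lemma ldvd_trans n (X Y Z : 'M[R]_n) : ldvd X Y -> ldvd Y Z -> ldvd X Z.
Proof.
by move=> [A A0 <-] [B B0 <-]; exists (A *m B); rewrite ?mulmxA //; apply/nonsingM.
Qed.

Lemma ldvd_refl n (X : 'M[R]_n) : ldvd X X.
Proof. by exists 1%:M; rewrite ?mulmx1 //; exact: nonsing1. Qed.

Lemma lassocP n (X Y : 'M[R]_n) : nonsing X ->
  lassoc X Y <-> exists2 U, U \in unitmx & Y = X *m U.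
Proof.
move=> X0; split=> [[[A A0 hA] [B B0 hB]]|[U Uu ->]].
  exists A => //.
  have /(nonsing_inj X0) h : X *m (A *m B) = X *m 1%:M by rewrite mulmxA hA hB mulmx1.
  by have [] := mulmx1_unit h.
split; first by exists U => //; exact: nonsing_unit.
exists (invmx U); last by rewrite mulmxK.
by apply: nonsing_unit; rewrite unitmx_inv.
Qed.

Lemma lclassP n (X Y : 'M[R]_n) : lclass X = lclass Y <-> lassoc X Y.
Proof.
split=> [h|[XY YX]].
  have : lclass Y Y by split; exact: ldvd_refl.
  by rewrite -h.
apply/seteqP; split=> Z [h1 h2]; split.
- exact: ldvd_trans YX h1.
- exact: ldvd_trans h2 XY.
- exact: ldvd_trans XY h1.
- exact: ldvd_trans h2 YX.
Qed.

(** ** Column reduction *)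

Lemma bezout_block_unit (a b x y : R) : x * a + y * b = 1 ->
  (block_mx a%:M (- y)%:M b%:M x%:M : 'M[R]_(1 + 1)) \in unitmx.
Proof.
move=> h; suff E : (block_mx a%:M (- y)%:M b%:M x%:M : 'M[R]_(1 + 1)) *m
    block_mx x%:M y%:M (- b)%:M a%:M = 1%:M by have [] := mulmx1_unit E.
rewrite mulmx_block -!scalar_mxM -!raddfD /= scalar_mx_block; congr block_mx.
- by rewrite -h; congr (_%:M); ring.
- by rewrite (_ : _ + _ = 0) ?raddf0 //; ring.
- by rewrite (_ : _ + _ = 0) ?raddf0 //; ring.
- by rewrite -h; congr (_%:M); ring.
Qed.

(** Euclid's algorithm: the tail of v is reduced to a multiple of the first basis
    vector by induction, and a Bezout block of size 2 merges it with the first entry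
    of v.  The first column of U is then v divided by the gcd of its entries. *)
Lemma vec_reduce n (v : 'cV[R]_n.+1) :
  exists2 U, U \in unitmx & exists g, v = U *m (g *: delta_mx 0 0).
Proof.
elim: n v => [|n IH] v.
  exists 1%:M; first exact: unitmx1.
  exists (v 0 0); rewrite mul1mx; apply/matrixP => i j.
  by rewrite !ord1 !mxE eqxx mulr1.
rewrite -[v](@vsubmxK _ 1 n.+1 1).
set v0 := usubmx _; set v' := dsubmx _.
have [U' U'u [g' hv']] := IH v'.
have [g [x [y [a [b [ha hb hg]]]]]] := bezout R_pid (v0 0 0) g'.
have [g0|g0] := eqVneq g 0.
  exists 1%:M; first exact: unitmx1.
  exists 0; rewrite scale0r mulmx0 hv' hb (mx11_scalar v0) ha g0 !mul0r.
  by rewrite scale0r mulmx0 raddf0 col_mx0.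
have xab : x * a + y * b = 1.
  by apply: (mulfI g0); rewrite mulr1 mulrDr !(mulrCA g) -ha -hb.
pose T2 : 'M[R]_(1 + 1) := block_mx a%:M (- y)%:M b%:M x%:M.
pose T : 'M[R]_(1 + 1 + n) := block_mx T2 0 0 1%:M.
pose V : 'M[R]_(1 + n.+1) := block_mx 1%:M 0 0 U'.
have Tu : T \in unitmx.
  by rewrite unitmxE /T det_ublock det1 mulr1 -unitmxE; exact: bezout_block_unit.
have Vu : V \in unitmx by rewrite unitmxE /V det_ublock det1 mul1r -unitmxE.
exists (V *m (T : 'M[R]_(1 + n.+1))).
  by rewrite unitmx_mul Vu; exact: Tu.
exists g; rewrite -mulmxA.
have -> : (T : 'M[R]_(1 + n.+1)) *m (g *: delta_mx 0 0) =
     col_mx v0 (g' *: delta_mx 0 0).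
  (* Both vectors have one or two nonzero entries; the two block decompositions
     1 + (1 + n) and (1 + 1) + n of the same index set are compared entrywise. *)
  have e1 : (g *: delta_mx 0 0 : 'cV[R]_(1 + n.+1)) =
      (col_mx (col_mx g%:M 0) 0 : 'cV[R]_(1 + 1 + n)).
    apply/matrixP => i j; rewrite !ord1 !mxE eqxx andbT.
    case: splitP => k hk; rewrite !mxE.
      case: splitP => l hl; rewrite !mxE ?ord1.
        by rewrite (_ : i == 0) ?mulr1 ?mulr1n //; apply/eqP/val_inj; rewrite /= hk hl ord1.
      by rewrite (_ : i == 0 = false) ?mulr0 //; apply/eqP => /(congr1 val); rewrite /= hk hl.
    by rewrite (_ : i == 0 = false) ?mulr0 //; apply/eqP => /(congr1 val); rewrite /= hk.
  have e2 (w : 'M[R]_1) : col_mx w (g' *: delta_mx 0 0) =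
      (col_mx (col_mx w g'%:M) 0 : 'cV[R]_(1 + 1 + n)).
    apply/matrixP => i j; rewrite !ord1 !mxE.
    case: splitP => k hk; rewrite ?mxE; case: splitP => l hl; rewrite ?mxE.
    - case: splitP => m hm; first by rewrite !ord1.
      by exfalso; have := etrans (esym hk) hl; move: hm (ltn_ord k) => /=; lia.
    - by exfalso; have := etrans (esym hk) hl; move: (ltn_ord k) => /=; lia.
    - have kl := etrans (esym hk) hl; case: splitP => m hm.
        by exfalso; move: kl hm (ltn_ord m) => /=; lia.
      rewrite mxE !ord1 eqxx andbT (_ : k == 0) ?mulr1 ?mulr1n //.
      by apply/eqP/val_inj; move: kl hm (ltn_ord m) => /=; lia.
    - have kl := etrans (esym hk) hl.
      rewrite eqxx andbT (_ : k == 0 = false) ?mulr0 //.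
      by apply/eqP => /(congr1 val) /= k0; move: kl => /=; lia.
  rewrite e2 e1; have -> // : T *m (col_mx (col_mx g%:M 0) 0) = col_mx (col_mx v0 g'%:M) 0.
  rewrite /T mul_block_col !(mul0mx, mulmx0, addr0) /T2 mul_block_col !(mul0mx, mulmx0, addr0).
  by rewrite -!scalar_mxM [v0]mx11_scalar ha hb; congr col_mx; congr col_mx; rewrite mulrC.
suff Ev : V *m (col_mx v0 (g' *: delta_mx 0 0)) = col_mx v0 v' by exact: esym.
by rewrite /V mul_block_col !mul1mx !mul0mx add0r addr0 hv'.
Qed.

(** A nonzero vector killed by B, divided by the gcd of its entries, is still killed
    by B; it becomes the first column of an invertible matrix. *)
Lemma vec_reduce_ker n m (B : 'M[R]_(m, 1 + n)) (v : 'cV[R]_(1 + n)) :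
  v != 0 -> B *m v = 0 -> exists2 U : 'M[R]_(1 + n), U \in unitmx & lsubmx (B *m U) = 0.
Proof.
move=> v0 Bv; have [U Uu [g hv]] := vec_reduce v.
exists U => //.
have g0 : g != 0 by apply: contra_neq v0 => g0; rewrite hv g0 scale0r mulmx0.
move: Bv; rewrite hv mulmxA -scalemxAr -colE => h.
apply/matrixP => i j; rewrite ord1 !mxE.
have /matrixP/(_ i 0) := h; rewrite !mxE => /eqP.
rewrite mulf_eq0 (negbTE g0) /= => /eqP; apply: etrans.
by apply: eq_bigr => k _; congr (_ * U _ _); apply: val_inj.
Qed.

(** The first column of the adjugate of X is killed by all rows of X but the first, so
    [vec_reduce_ker] applies to these rows. *)
Lemma triangularize n (X : 'M[R]_(1 + n)) : nonsing X ->
  exists2 U : 'M[R]_(1 + n), U \in unitmx &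
  exists d w X', X *m U = block_mx d%:M w 0 X'.
Proof.
move=> X0.
have [||U Uu hU] := @vec_reduce_ker n n (dsubmx X) (col 0 (\adj X)).
- apply/eqP => h; have : col 0 (X *m \adj X) = 0 by rewrite colE -mulmxA -colE h mulmx0.
  rewrite mul_mx_adj => /matrixP/(_ 0 0); rewrite !mxE eqxx mulr1n => /eqP.
  by rewrite (negbTE X0).
- rewrite mul_dsub_mx !colE mulmxA mul_mx_adj -colE.
  apply/matrixP => i j; rewrite !mxE.
  by rewrite (_ : _ == _ = false) ?mulr0n //; apply/eqP => /(congr1 val).
exists U => //; exists (ulsubmx (X *m U) 0 0), (ursubmx (X *m U)), (drsubmx (X *m U)).
rewrite -[LHS]submxK -mx11_scalar; congr block_mx.
by rewrite /dlsubmx -mul_dsub_mx.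
Qed.

(** ** Norm of a matrix *)

Definition mnorm n (X : 'M[R]_n) : nat := absnorm (\det X).

Lemma mnormM n (X Y : 'M[R]_n) : nonsing X -> nonsing Y ->
  mnorm (X *m Y) = (mnorm X * mnorm Y)%N.
Proof. by move=> X0 Y0; rewrite /mnorm det_mulmx absnormM. Qed.

Lemma mnorm_gt0 n (X : 'M[R]_n) : nonsing X -> (0 < mnorm X)%N.
Proof. exact: absnorm_gt0. Qed.

Lemma mnorm_unit n (X : 'M[R]_n) : nonsing X -> (mnorm X == 1%N) = (X \in unitmx).
Proof.
move=> X0; rewrite unitmxE; apply/eqP/idP; first exact: absnorm_eq1.
exact: absnorm_unit.
Qed.

(** ** Right ideals are principal and least common multiples exist *)

(** The lattice generated by the columns of L and by y is again spanned by n columns,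
    those of G: the n + 1 generators satisfy the relation
    det L * y = L * (adj L * y), and a change of generators turns this relation into
    the vanishing of one of them. *)
Lemma adjoin_column n (L : 'M[R]_n) (y : 'cV[R]_n) : nonsing L ->
  exists (G D : 'M[R]_n) (c : 'cV[R]_n) (p : 'rV[R]_n) (q : 'M[R]_n),
    [/\ L = G *m D, y = G *m c & G = y *m p + L *m q].
Proof.
move=> L0.
have [||U Uu hU] := @vec_reduce_ker n n (row_mx y L) (col_mx (\det L)%:M (- (\adj L *m y))).
- apply/eqP => /matrixP/(_ (lshift _ 0) 0); rewrite col_mxEu !mxE eqxx mulr1n => /eqP.
  by rewrite (negbTE L0).
- rewrite mul_row_col mulmxN mulmxA mul_mx_adj mul_mx_scalar mul_scalar_mx.
  exact: subrr.
pose G := rsubmx (row_mx y L *m U).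
have E : row_mx y L = row_mx 0 G *m invmx U.
  by rewrite -hU hsubmxK mulmxK.
exists G, (drsubmx (invmx U)), (dlsubmx (invmx U)), (ursubmx U), (drsubmx U).
move: E; rewrite -{1}[invmx U]submxK mul_row_block !mul0mx !add0r => /eq_row_mx[hy hL].
split=> //; by rewrite /G -{1}[U]submxK mul_row_block row_mxKr.
Qed.

(** A generator is an element L of least norm: adjoining to L a column of another
    element of S gives, by [adjoin_column], an element G of S dividing L on the left,
    so G has the same norm as L and spans the same lattice. *)
Lemma principal_right_ideal n (S : set 'M[R]_n) :
  (forall A B Z W, S A -> S B -> S (A *m Z + B *m W)) ->
  (exists2 A, S A & nonsing A) ->
  exists L, [/\ S L, nonsing L & forall Y, S Y -> exists Z, Y = L *m Z].
Proof.
move=> SS [A SA A0].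
have [L [SL L0 Lmin]] : exists L, [/\ S L, nonsing L &
    forall G, S G -> nonsing G -> (mnorm L <= mnorm G)%N].
  have [k] := ubnP (mnorm A); elim: k A SA A0 => // k IH A SA A0 Ak.
  have [[G [SG G0 GA]]|noG] := pselect (exists G, [/\ S G, nonsing G & (mnorm G < mnorm A)%N]).
    by apply: (IH G) => //; lia.
  exists A; split=> // G SG G0; rewrite leqNgt; apply/negP => GA.
  by apply: noG; exists G.
exists L; split=> // Y SY.
have col_in j : exists z : 'cV[R]_n, col j Y = L *m z.
  have [G [D [c [p [q [hL hy hG]]]]]] := adjoin_column (col j Y) L0.
  have [G0 D0] : nonsing G /\ nonsing D by apply/nonsingM; rewrite -hL.
  have SG : S G by rewrite hG colE -mulmxA; apply: SS.
  have Du : D \in unitmx.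
    rewrite -mnorm_unit //; have := Lmin G SG G0; rewrite hL mnormM //.
    have := mnorm_gt0 G0; have := mnorm_gt0 D0; nia.
  exists (invmx D *m c); rewrite mulmxA {1}hL.
  by rewrite mulmxK.
have [f hf] := choice col_in.
exists (\matrix_(i, j) f j i 0); apply/matrixP => i j.
have /matrixP/(_ i 0) := hf j; rewrite !mxE => ->.
by apply: eq_bigr => k _; rewrite !mxE.
Qed.

End Matrices.

(** * Classes of matrices and their duality with sets of irreducible classes *)

Lemma big_fset_filter (V : nmodType) (T : choiceType) (A : {fset T}) (P : pred T)
    (F : T -> V) :
  \sum_(i <- A | P i) F i = \sum_(i <- [fset i in A | P i]%fset) F i.
Proof. by rewrite big_fset. Qed.

(** Adding or removing a fixed element of A pairs off subsets with opposite signs. *)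
Lemma sum_sign_powerset (T : choiceType) (A : {fset T}) :
  \sum_(J <- fpowerset A) (-1) ^+ #|` J|%fset = (A == fset0)%:R :> int.
Proof.
have [->|/fset0Pn[x xA]] := eqVneq A fset0.
  by rewrite fpowerset0 big_seq_fset1 cardfs0 expr0.
rewrite (big_fsetID _ (fun J : {fset T} => x \in J)) /=.
have -> : [fset J in fpowerset A | x \in J]%fset =
    [fset (x |` J)%fset | J in [fset J in fpowerset A | x \notin J]%fset]%fset.
  apply/fsetP => J; apply/idP/imfsetP.
    rewrite !inE /= fpowersetE => /andP[JA xJ]; exists (J `\ x)%fset.
      by rewrite !inE /= fpowersetE eqxx /= andbT (fsubset_trans (fsubD1set _ _)).
    by rewrite fsetD1K.
  move=> [I /=]; rewrite !inE /= !fpowersetE => /andP[IA xI] ->.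
  by rewrite fsubUset fsub1set xA IA /= in_fset1U eqxx.
rewrite big_imfset /=; last first.
  move=> I J; rewrite !inE /= => /andP[_ xI] /andP[_ xJ] h.
  by rewrite -(fsetU1K xI) -(fsetU1K xJ) h.
rewrite -big_split /= big1_seq // => J; rewrite !inE /= => /andP[_ xJ].
by rewrite cardfsU1 xJ exprS mulN1r addNr.
Qed.

Section Classes.
Variable R : idomainType.
Hypothesis R_pid : is_PID R.
Hypothesis R_fin : residue_finite R.
Variable n : nat.
Implicit Types (X Y Z L : 'M[R]_n) (c : set 'M[R]_n).

(** The representative by which the degree of a class is computed. *)
Definition class_rep c : 'M[R]_n := xget 1%:M c.
Definition class_mnorm c : nat := mnorm (class_rep c).

Lemma class_rep_lclass X : lassoc X (class_rep (lclass X)).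
Proof.
rewrite /class_rep; case: xgetP => [Y _ //|/(_ X)[]].
by split; exact: ldvd_refl.
Qed.

Lemma class_repP c : @lclasses R n c -> nonsing (class_rep c) /\ lclass (class_rep c) = c.
Proof.
move=> [X X0 <-]; have [h1 h2] := class_rep_lclass X.
split; last by apply/lclassP; split.
by case: h1 => Z Z0 <-; apply/nonsingM.
Qed.

Lemma mnorm_lassoc X Y : nonsing X -> lassoc X Y -> mnorm Y = mnorm X.
Proof.
move=> X0 /(lassocP _ X0)[U Uu ->]; by rewrite /mnorm det_mulmx absnorm_assoc.
Qed.

Lemma class_mnorm_lclass X : nonsing X -> class_mnorm (lclass X) = mnorm X.
Proof. by move=> X0; apply: mnorm_lassoc => //; exact: class_rep_lclass. Qed.

Lemma class_mnorm_gt0 c : @lclasses R n c -> (0 < class_mnorm c)%N.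
Proof. by move=> /class_repP[h _]; exact: mnorm_gt0. Qed.

Lemma I0_lclasses c : @I0 R n c -> @lclasses R n c.
Proof. by move=> [X [X0 _ _] <-]; exists X. Qed.

Lemma mnorm_ldvd X Y : nonsing X -> ldvd X Y -> (mnorm X %| mnorm Y)%N.
Proof. by move=> X0 [Z Z0 <-]; rewrite mnormM // dvdn_mulr. Qed.

(** The scalar matrix det X is a multiple of X and commutes with every matrix. *)
Lemma common_multiple_exists (s : seq 'M[R]_n) : (forall X, X \in s -> nonsing X) ->
  exists2 A, nonsing A & forall X, X \in s -> exists Z, A = X *m Z.
Proof.
elim: s => [|X s IH] hs; first by exists 1%:M => //; exact: nonsing1.
have [|A A0 hA] := IH; first by move=> Y Ys; apply: hs; rewrite inE Ys orbT.
have X0 : nonsing X by apply: hs; rewrite inE eqxx.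
exists ((\det X)%:M *m A).
  by apply/nonsingM; split=> //; rewrite /nonsing /= det_scalar expf_neq0.
move=> Y; rewrite inE => /orP[/eqP ->|/hA[Z ->]].
  by exists (\adj X *m A); rewrite mulmxA mul_mx_adj.
by exists (Z *m (\det X)%:M); rewrite -scalar_mxC mulmxA.
Qed.

(** The common multiples, together with singular matrices with the same divisibility
    property, form a right ideal. *)
Lemma LCM_exists (J : {fset set 'M[R]_n}) : [set` J] `<=` @lclasses R n ->
  exists L, [/\ nonsing L, LCM [set` J] = lclass L &
   forall Z, nonsing Z -> (ldvd L Z <-> forall c, c \in J -> ldvd (class_rep c) Z)].
Proof.
move=> JC.
pose S := [set Y : 'M[R]_n | forall c, c \in J -> exists Z, Y = class_rep c *m Z].
have [||L [SL L0 Lmin]] := @principal_right_ideal _ R_pid R_fin n S.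
- move=> A B Z W hA hB c cJ; have [A' ->] := hA c cJ; have [B' ->] := hB c cJ.
  by exists (A' *m Z + B' *m W); rewrite mulmxDr !mulmxA.
- have [|A A0 hA] := @common_multiple_exists [seq class_rep c | c <- J].
    by move=> _ /mapP[c /JC/class_repP[h _] ->].
  by exists A => // c cJ; apply: hA; apply: map_f.
have LZ Z : nonsing Z -> (ldvd L Z <-> forall c, c \in J -> ldvd (class_rep c) Z).
  move=> Z0; split=> [LZ c cJ|h].
    by apply: ldvd_trans LZ; apply/ldvdP => //; exact: SL.
  by apply/ldvdP => //; apply: Lmin => c /h /(ldvdP _ Z0).
exists L; split=> //.
have cmP L' : common_multiple [set` J] L' <-> nonsing L' /\ ldvd L L'.
  split=> [[L'0 h]|[L'0 /(LZ _ L'0) h]].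
    split=> //; apply/LZ => // c cJ; have [c0 cc] := class_repP (JC c cJ).
    by apply: h => //=; rewrite cc.
  split=> // X X0 /= /h; have [XX _] := class_rep_lclass X; exact: ldvd_trans.
apply/seteqP; split=> L'.
  move=> [/cmP[L'0 LL'] min]; split=> //; apply: min; apply/cmP; split=> //.
  exact: ldvd_refl.
move=> [LL' L'L]; split.
  by apply/cmP; split=> //; case: LL' => Z Z0 <-; apply/nonsingM.
by move=> L'' /cmP[_]; exact: ldvd_trans.
Qed.

(** Both factors of a product of noninvertible matrices have smaller norm. *)
Lemma irreducible_divisor Z : nonsing Z -> Z \notin unitmx ->
  exists2 X, irreducible_mx X & ldvd X Z.
Proof.
have [k] := ubnP (mnorm Z); elim: k Z => // k IH Z Zk Z0 Zu.
have [[A [B [A0 B0 ZAB Au Bu]]]|irr] := pselect (exists A B,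
    [/\ nonsing A, nonsing B, Z = A *m B, A \notin unitmx & B \notin unitmx]).
  have [||//|X Xi XA] := IH A.
  - move: Zk Bu; rewrite ZAB mnormM // -mnorm_unit // => Zk Bu.
    have := mnorm_gt0 R_fin A0; have := mnorm_gt0 R_fin B0; move: Zk Bu.
    by case: (mnorm B) => [|[|k']] //; nia.
  - by [].
  by exists X => //; apply: ldvd_trans XA _; rewrite ZAB; exact: ldvd_mul.
exists Z; last exact: ldvd_refl.
split=> // A B A0 B0 ZAB.
have [Au|Au] := boolP (A \in unitmx); first by left.
have [Bu|Bu] := boolP (B \in unitmx); first by right.
by case: irr; exists A, B.
Qed.

(** ** Duality between classes and finite sets of irreducible classes *)

Section Duality.

Definition classes_of_norm (m : nat) := [set c | @lclasses R n c /\ class_mnorm c = m].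

Hypothesis fin : forall m, finite_set (classes_of_norm m).

Definition num_classes m : nat := #|` fset_set (classes_of_norm m)|%fset.

(** The coefficient of m^(-s) in the skew-growth series. *)
Definition sign_sum (m : nat) : int :=
  \sum_(J \in [set J : {fset set 'M[R]_n} |
     [set` J] `<=` @I0 R n /\ class_mnorm (LCM [set` J]) = m]) ((-1) ^+ #|` J|%fset : int).

(** Left multiplication by L is injective on classes, and multiplies the norm by that
    of L. *)
Lemma num_multiples L m : nonsing L -> (mnorm L %| m)%N -> (0 < m)%N ->
  num_classes (m %/ mnorm L) =
  #|` [fset c in fset_set (classes_of_norm m) | `[< ldvd L (class_rep c) >]]|%fset.
Proof.
move=> L0 Lm m0; rewrite /num_classes.
have L1 := mnorm_gt0 R_fin L0.
transitivity #|` [fset lclass (L *m class_rep c) | c in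
    fset_set (classes_of_norm (m %/ mnorm L))]|%fset.
  rewrite card_in_imfset //.
  move=> c d; rewrite !in_fset_set // !in_setE => -[/class_repP[c0 cc] _] [/class_repP[d0 dd] _].
  move=> /lclassP/lassocP[|U Uu]; first exact/nonsingM.
  rewrite -mulmxA => /(nonsing_inj L0) h.
  by rewrite -cc -dd; apply/lclassP/lassocP => //; exists U.
congr (#|` _|%fset); apply/fsetP => c; apply/imfsetP/idP => /=.
  move=> [d]; rewrite in_fset_set // in_setE => -[/class_repP[d0 dd] nd] ->.
  have Ld0 : nonsing (L *m class_rep d) by exact/nonsingM.
  rewrite !inE /= in_fset_set //; apply/andP; split.
    rewrite in_setE; split; first by exists (L *m class_rep d).
    rewrite class_mnorm_lclass // mnormM // [mnorm (class_rep d)]nd.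
    by rewrite mulnC divnK.
  apply/asboolP; have [h _] := class_rep_lclass (L *m class_rep d).
  by apply: ldvd_trans h; exact: ldvd_mul.
rewrite !inE /= in_fset_set // => /andP[]; rewrite in_setE => -[cC nc] /asboolP[Z Z0 hZ].
have [c0 cc] := class_repP cC.
have [h1 h2] := class_rep_lclass Z.
exists (lclass Z).
  rewrite in_fset_set // in_setE; split; first by exists Z.
  by rewrite class_mnorm_lclass // -nc /class_mnorm -hZ mnormM // mulKn.
rewrite -{1}cc -hZ; apply/lclassP.
have /(lassocP _ Z0)[U Uu ->] := class_rep_lclass Z.
by apply/lassocP; [exact/nonsingM | exists U; rewrite ?mulmxA].
Qed.

Lemma irr_bounded_finite m : finite_set [set c | @I0 R n c /\ (class_mnorm c <= m)%N].
Proof.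
apply: (@sub_finite_set _ _ (\bigcup_(k in `I_m.+1) classes_of_norm k)).
  by move=> c [ci cm]; exists (class_mnorm c) => //; split=> //; exact: I0_lclasses.
by apply: bigcup_finite => // ; exact: finite_II.
Qed.

(** Both sides count, with sign (-1)^#J, the pairs of a finite set J of irreducible
    classes and a class c of norm m such that LCM(J) divides c.  For a given J there
    are as many c as classes of norm m / N(LCM(J)).  For a given c the set J runs over
    all subsets of the set of irreducible divisors of c, and the signs cancel unless c
    is the class of the invertible matrices. *)
Lemma duality m : (0 < m)%N ->
  \sum_(d <- divisors m) sign_sum d * (num_classes (m %/ d))%:R = (m == 1%N)%:R.
Proof.
move=> m0.
pose F := fset_set [set c | @I0 R n c /\ (class_mnorm c <= m)%N].
have FP c : c \in F <-> @I0 R n c /\ (class_mnorm c <= m)%N.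
  by rewrite in_fset_set ?in_setE //; exact: irr_bounded_finite.
pose nJ (J : {fset set 'M[R]_n}) := class_mnorm (LCM [set` J]).
pose eps (J : {fset set 'M[R]_n}) : int := (-1) ^+ #|` J|%fset.
have PI J : J \in fpowerset F -> [set` J] `<=` @I0 R n.
  by rewrite fpowersetE => /fsubsetP JF c /JF/FP[].
have bE d : (d <= m)%N -> sign_sum d = \sum_(J <- fpowerset F | nJ J == d) eps J.
  move=> dm; rewrite /sign_sum.
  rewrite (_ : [set J | _] = [set` [fset J in fpowerset F | nJ J == d]%fset]); last first.
    apply/seteqP; split=> J /=.
      move=> [JI Jd]; rewrite !inE /= fpowersetE -/(nJ J) /nJ Jd eqxx andbT.
      have JC : [set` J] `<=` @lclasses R n by move=> c /JI/I0_lclasses.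
      apply/fsubsetP => c cJ; apply/FP; split; first exact: JI.
      have [L [L0 hL LZ]] := LCM_exists JC.
      move: Jd; rewrite hL class_mnorm_lclass // => Jd.
      rewrite (leq_trans _ dm) // -Jd dvdn_leq ?mnorm_gt0 // /class_mnorm mnorm_ldvd //.
        by have [] := class_repP (JC c cJ).
      by apply: (proj1 (LZ L L0)) cJ; exact: ldvd_refl.
    by rewrite !inE /= => /andP[/PI JI /eqP].
  by rewrite fsbig_finite //= set_fsetK big_fset.
pose D (J : {fset set 'M[R]_n}) c := `[< forall x, x \in J -> ldvd (class_rep x) (class_rep c) >].
transitivity (\sum_(J <- fpowerset F)
    \sum_(c <- fset_set (classes_of_norm m)) (if D J c then eps J else 0)).
  transitivity (\sum_(d <- divisors m) \sum_(J <- fpowerset F)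
      (if nJ J == d then eps J * (num_classes (m %/ d))%:R else 0)).
    apply: eq_big_seq => d; rewrite -dvdn_divisors // => dm.
    rewrite bE; last exact: dvdn_leq.
    rewrite mulr_suml.
    exact: big_mkcond.
  rewrite exchange_big /=; apply: eq_big_seq => J JF.
  have JC : [set` J] `<=` @lclasses R n by move=> c /(PI _ JF)/I0_lclasses.
  have [L [L0 hL LZ]] := LCM_exists JC.
  have nL : nJ J = mnorm L by rewrite /nJ hL class_mnorm_lclass.
  have DE c : c \in fset_set (classes_of_norm m) -> D J c = `[< ldvd L (class_rep c) >].
    rewrite in_fset_set // in_setE => -[/class_repP[c0 _] _].
    by apply/asboolP/asboolP => h; apply/LZ.
  rewrite (eq_big_seq _ (fun c cm => congr1 (fun b : bool => if b then eps J else 0) (DE c cm))).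
  rewrite -[RHS]big_mkcond /=.
  have [Lm|Lm] := boolP (mnorm L %| m)%N.
    rewrite (bigD1_seq (mnorm L)) /= ?divisors_uniq //; last by rewrite -dvdn_divisors.
    rewrite nL eqxx.
    rewrite big1 ?addr0; last by move=> d; rewrite eq_sym => /negbTE ->.
    rewrite num_multiples // big_fset_filter big_const_seq count_predT iter_addr_0.
    by rewrite mulr_natr.
  rewrite !big1_seq //.
    move=> c /andP[/asboolP Lc]; rewrite in_fset_set // in_setE => -[_ nc].
    by case/negP: Lm; rewrite -nc; exact: mnorm_ldvd.
  move=> d /andP[_]; rewrite -dvdn_divisors // nL => dm.
  by case: eqP => // Ld; case/negP: Lm; rewrite Ld.
rewrite exchange_big /=.
have inner c : c \in fset_set (classes_of_norm m) ->
    \sum_(J <- fpowerset F) (if D J c then eps J else 0) = (m == 1%N)%:R.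
  rewrite in_fset_set // in_setE => -[cC nc]; have [c0 cc] := class_repP cC.
  pose Fc := [fset x in F | `[< ldvd (class_rep x) (class_rep c) >]]%fset.
  rewrite -big_mkcond big_fset_filter.
  have -> : [fset J in fpowerset F | D J c]%fset = fpowerset Fc.
    apply/fsetP => J; rewrite !inE /= !fpowersetE; apply/andP/fsubsetP.
      move=> [/fsubsetP JF /asboolP Jc] x xJ; rewrite !inE /= JF //=.
      by apply/asboolP; exact: Jc.
    move=> JFc; split.
      by apply/fsubsetP => x /JFc; rewrite !inE /= => /andP[].
    by apply/asboolP => x /JFc; rewrite !inE /= => /andP[_ /asboolP].
  rewrite sum_sign_powerset; congr (nat_of_bool _)%:R.
  have -> : (m == 1%N) = (class_rep c \in unitmx) by rewrite -nc /class_mnorm mnorm_unit.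
  have [cu|cu] := boolP (class_rep c \in unitmx).
    apply/eqP/fsetP => x; rewrite !inE /=; apply/negP => /andP[/FP[[X [X0 Xu _] <-] _]].
    move=> /asboolP [Z Z0 hZ]; case/negP: Xu.
    have [h _] := class_rep_lclass X; case: h => W W0 hW.
    by move: cu; rewrite -hZ -hW !unitmx_mul => /andP[/andP[]].
  apply/negbTE/fset0Pn; have [X Xi Xc] := irreducible_divisor c0 cu.
  have [X0 _ _] := Xi; have [h1 h2] := class_rep_lclass X.
  exists (lclass X); rewrite !inE /=; apply/andP; split.
    apply/FP; split; first by exists X.
    rewrite class_mnorm_lclass // dvdn_leq //.
    by rewrite -nc; exact: mnorm_ldvd.
  by apply/asboolP; exact: ldvd_trans Xc.
rewrite (eq_big_seq _ inner); have [m1|m1] := eqVneq m 1%N; last by rewrite big1.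
rewrite big_const_seq count_predT iter_addr_0.
rewrite (_ : fset_set (classes_of_norm m) = [fset lclass 1%:M]%fset) ?cardfs1 //.
apply/fsetP => c; rewrite in_fset_set // inE; apply/idP/eqP.
  rewrite in_setE => -[/class_repP[c0 cc] nc].
  rewrite -cc; apply/lclassP.
  have cu : class_rep c \in unitmx by rewrite -mnorm_unit //; apply/eqP; rewrite -m1 -nc.
  apply/lassocP => //; exists (invmx (class_rep c)); first by rewrite unitmx_inv.
  by rewrite mulmxV.
move=> ->; rewrite in_setE; split; first by exists 1%:M => //; exact: nonsing1.
rewrite class_mnorm_lclass; last exact: nonsing1.
by rewrite m1; apply/eqP; rewrite mnorm_unit ?unitmx1 //; exact: nonsing1.
Qed.

End Duality.
End Classes.

(** * Unordered sums of complex numbers *)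

Section UnorderedSums.
Variable K : realType.
Local Notation C := (K[i]).
Local Notation cnorm := (@ComplexField.Normc.normc K).

Lemma cnormE (z : C) : `|z| = (cnorm z)%:C.
Proof. by case: z. Qed.

Lemma cnormD (x y : C) : cnorm (x + y) <= cnorm x + cnorm y.
Proof. exact: (@le_normcD K x y). Qed.

Lemma cnormM (x y : C) : cnorm (x * y) = cnorm x * cnorm y.
Proof. exact: ComplexField.Normc.normcM. Qed.

Lemma cnormN (x : C) : cnorm (- x) = cnorm x.
Proof. exact: (@normcN K x). Qed.

Lemma cnormB (x y : C) : cnorm (x - y) = cnorm (y - x).
Proof. by rewrite -cnormN opprB. Qed.

Lemma cnorm_ge0 (x : C) : 0 <= cnorm x.
Proof. by case: x => a b; rewrite /= sqrtr_ge0. Qed.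

Lemma cnorm_eq0 (x : C) : cnorm x = 0 -> x = 0.
Proof. exact: ComplexField.Normc.eq0_normc. Qed.

Lemma cnorm0 : cnorm 0 = 0.
Proof. exact: ComplexField.Normc.normc0. Qed.

Lemma cnorm1 : cnorm 1 = 1.
Proof. exact: ComplexField.Normc.normc1. Qed.

Lemma cnorm_real (x : K) : cnorm x%:C = `|x|.
Proof. by rewrite /= expr0n addr0 sqrtr_sqr. Qed.

Lemma cnormRe (z : C) : `|complex.Re z| <= cnorm z.
Proof.
case: z => a b /=; rewrite -(sqrtr_sqr a) ler_sqrt ?lerDl ?sqr_ge0 //.
by rewrite addr_ge0 ?sqr_ge0.
Qed.

Lemma cnormIm (z : C) : `|complex.Im z| <= cnorm z.
Proof.
case: z => a b /=; rewrite -(sqrtr_sqr b) ler_sqrt ?lerDr ?sqr_ge0 //.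
by rewrite addr_ge0 ?sqr_ge0.
Qed.

Lemma cnorm_sum (I : Type) (s : seq I) (f : I -> C) :
  cnorm (\sum_(i <- s) f i) <= \sum_(i <- s) cnorm (f i).
Proof.
elim: s => [|a s IH]; first by rewrite !big_nil cnorm0.
by rewrite !big_cons (le_trans (cnormD _ _)) // lerD2l.
Qed.

Lemma cnorm_natr (m : nat) : cnorm m%:R = m%:R.
Proof. by rewrite -(rmorph_nat (real_complex K)) cnorm_real ger0_norm. Qed.

(** ** Nets indexed by the finite subsets of a type *)

Section Nets.
Variable I : choiceType.

#[global] Instance totally_proper : ProperFilter (@totally I).
Proof.
apply: filter_from_proper; last by move=> A _; exists A; rewrite /= fsubset_refl.
apply: filter_from_filter; first by exists fset0.
move=> A B _ _; exists (A `|` B)%fset => //= X.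
by rewrite /= fsubUset => /andP[].
Qed.

(** Convergence along the finite subsets, with a real modulus and a real error: linear
    arithmetic applies to these, whereas the order on complex numbers is partial. *)
Definition net_lim (F : {fset I} -> C) (l : C) := forall e : K, 0 < e ->
  exists A : {fset I}, forall B : {fset I}, (A `<=` B)%fset -> cnorm (F B - l) < e.

Lemma net_limP (F : {fset I} -> C) (l : C) :
  ((F : _ -> C^o) @ @totally I --> (l : C^o)) <-> net_lim F l.
Proof.
split.
- move=> /cvgrPdist_lt H e e0.
  have e0' : (0 : C) < e%:C by rewrite ltcR.
  have [A _ HA] := H _ e0'.
  exists A => B AB; move: (HA B AB) => /=.
  by rewrite cnormE ltcR cnormB.
- move=> H; apply/cvgrPdist_lt => e; rewrite ltcE => /andP[/eqP Ie Re0].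
  have [A HA] := H _ Re0.
  exists A => // B /= AB; have := HA B AB.
  rewrite cnormB => h; rewrite cnormE ltcE /= h andbT.
  by rewrite Ie eqxx.
Qed.

Lemma net_lim_lim F l : net_lim F l ->
  lim ((F : _ -> C^o) @ @totally I) = l.
Proof. by move=> /net_limP h; exact: (cvg_lim (@norm_hausdorff _ C^o) h). Qed.

Lemma net_lim_unique F l l' : net_lim F l -> net_lim F l' -> l = l'.
Proof. by move=> /net_lim_lim <- /net_lim_lim <-. Qed.

Lemma net_limV F l : l != 0 -> net_lim F l -> net_lim (fun A => (F A)^-1) l^-1.
Proof. by move=> l0 /net_limP h; apply/net_limP; exact: (@cvgV C _ _ _ F l l0 h). Qed.

Lemma net_limM F G l m : net_lim F l -> net_lim G m ->
  net_lim (fun A => F A * G A) (l * m).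
Proof. by move=> /net_limP h /net_limP h'; apply/net_limP; exact: (@cvgM C _ _ _ F G l m h h'). Qed.

Lemma net_limD F G l m : net_lim F l -> net_lim G m ->
  net_lim (fun A => F A + G A) (l + m).
Proof. by move=> /net_limP h /net_limP h'; apply/net_limP; exact: (@cvgD C C^o _ _ _ F G l m h h'). Qed.

Lemma net_lim_cst l : net_lim (fun=> l) l.
Proof. by apply/net_limP; exact: cvg_cst. Qed.

Lemma net_lim_prod (J : Type) (s : seq J) (F : J -> {fset I} -> C) (l : J -> C) :
  (forall j, net_lim (F j) (l j)) ->
  net_lim (fun A => \prod_(j <- s) F j A) (\prod_(j <- s) l j).
Proof.
move=> h; elim: s => [|j s IH].
  rewrite big_nil (_ : (fun _ => _) = fun=> 1); first exact: net_lim_cst.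
  by apply/funext => A; rewrite big_nil.
rewrite big_cons (_ : (fun _ => _) = fun A => F j A * \prod_(k <- s) F k A).
  exact: net_limM.
by apply/funext => A; rewrite big_cons.
Qed.

End Nets.

(** ** Unordered sums *)

Definition has_sum (I : choiceType) (f : I -> C) (l : C) :=
  net_lim (fun B : {fset I} => \sum_(i <- B) f i) l.

(** A uniform bound on the finite partial sums; for a nonnegative family this is
    summability, with the bound kept explicit. *)
Definition sums_le (I : choiceType) (u : I -> K) (M : K) :=
  forall A : {fset I}, \sum_(i <- A) u i <= M.

Definition abs_sums_le (I : choiceType) (f : I -> C) (M : K) :=
  sums_le (cnorm \o f) M.

Section Sums.
Variable I : choiceType.
Implicit Types (f g : I -> C) (u v : I -> K).

Lemma has_sum_unique f l l' : has_sum f l -> has_sum f l' -> l = l'.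
Proof. exact: net_lim_unique. Qed.

Lemma has_sumD f g l m : has_sum f l -> has_sum g m -> has_sum (fun i => f i + g i) (l + m).
Proof.
move=> hf hg; have := net_limD hf hg; rewrite /has_sum.
by congr net_lim; apply/funext => A; rewrite big_split.
Qed.

Lemma has_sumZ c f l : has_sum f l -> has_sum (fun i => c * f i) (c * l).
Proof.
move=> hf; have := net_limM (@net_lim_cst I c) hf; rewrite /has_sum.
by congr net_lim; apply/funext => A; rewrite big_distrr.
Qed.

Lemma has_sumN f l : has_sum f l -> has_sum (fun i => - f i) (- l).
Proof.
move=> /(has_sumZ (-1)); rewrite mulN1r; congr has_sum.
by apply/funext => i; rewrite mulN1r.
Qed.

Lemma sums_ge0 u M : sums_le u M -> 0 <= M.
Proof. by move=> /(_ fset0); rewrite big_seq_fset0. Qed.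

Lemma sums_le_dom u v M : (forall i, v i <= u i) -> sums_le u M -> sums_le v M.
Proof. by move=> h hu A; apply: le_trans (hu A); exact: ler_sum. Qed.

Lemma sums_leZ c u M : 0 <= c -> sums_le u M -> sums_le (fun i => c * u i) (c * M).
Proof. by move=> c0 hu A; rewrite -mulr_sumr ler_wpM2l. Qed.

Lemma sums_leD u v M M' : sums_le u M -> sums_le v M' ->
  sums_le (fun i => u i + v i) (M + M').
Proof. by move=> hu hv A; rewrite big_split lerD. Qed.

Lemma sum_fset_le u (A B : {fset I}) : (forall i, 0 <= u i) ->
  (A `<=` B)%fset -> \sum_(i <- A) u i <= \sum_(i <- B) u i.
Proof.
move=> u0 AB; rewrite (big_fsetID _ (mem A) B) /=.
rewrite (_ : [fset x in B | x \in A]%fset = A); last first.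
  apply/fsetP => x; rewrite !inE /= andbC.
  by case: (boolP (x \in A)) => // /(fsubsetP AB) ->.
by rewrite lerDl sumr_ge0.
Qed.

(** A nonnegative family with bounded partial sums converges to their supremum. *)
Lemma has_sum_pos u M : (forall i, 0 <= u i) -> sums_le u M ->
  exists l, has_sum (fun i => (u i)%:C) l.
Proof.
move=> u0 hu.
pose E := [set \sum_(i <- A) u i | A in [set: {fset I}]].
have supE : has_sup E.
  split; first by exists 0; exists fset0; rewrite // big_seq_fset0.
  by exists M => _ [A _ <-].
exists (sup E)%:C => e e0.
have [_ [A _ <-] hA] := sup_adherent e0 supE.
exists A => B AB; rewrite -rmorph_sum -rmorphB cnorm_real.
have h1 : \sum_(i <- B) u i <= sup E by apply: sup_upper_bound => //; exists B.
have h2 := sum_fset_le u0 AB.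
by rewrite ler0_norm ?subr_le0 // opprB ltrBlDl -ltrBlDr (lt_le_trans hA).
Qed.

(** The real and imaginary parts are differences of nonnegative summable families,
    u = (|u| + u) - |u|. *)
Lemma has_sum_abs f M : abs_sums_le f M -> exists l, has_sum f l.
Proof.
move=> hf.
have H (u : I -> K) : (forall i, `|u i| <= cnorm (f i)) -> exists l, has_sum (fun i => (u i)%:C) l.
  move=> hu.
  have [||l1 h1] := @has_sum_pos (fun i => `|u i| + u i) (M + M).
  - by move=> i; rewrite -lerBlDr sub0r -normrN ler_norm.
  - apply: sums_le_dom (sums_leD hf hf) => i /=.
    by rewrite lerD // (le_trans (ler_norm _)).

  have [||l2 h2] := @has_sum_pos (fun i => `|u i|) M; first by move=> i.
    by apply: sums_le_dom hf => i /=.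
  exists (l1 - l2); move: (has_sumD h1 (has_sumN h2)); congr has_sum.
  by apply/funext => i; rewrite -rmorphB addrAC subrr add0r.
have [l1 h1] := H (fun i => complex.Re (f i)) (fun i => cnormRe _).
have [l2 h2] := H (fun i => complex.Im (f i)) (fun i => cnormIm _).
exists (l1 + 'i%C * l2); move: (has_sumD h1 (has_sumZ 'i%C h2)); congr has_sum.
by apply/funext => i; rewrite -complexE.
Qed.

Lemma has_sum_le f l M : has_sum f l -> abs_sums_le f M -> cnorm l <= M.
Proof.
move=> hf hM; apply/ler_addgt0Pr => e e0.
have [A /(_ _ (fsubset_refl _)) hA] := hf _ e0.
rewrite -(subrK (\sum_(i <- A) f i) l) addrC (le_trans (cnormD _ _)) //.
rewrite lerD //; last by rewrite cnormB ltW.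
by rewrite (le_trans (cnorm_sum _ _)) // hM.
Qed.

Lemma has_sum1 f (a : I) : (forall i, i != a -> f i = 0) -> has_sum f (f a).
Proof.
move=> h e e0; exists [fset a]%fset => B AB.
rewrite -(@big_fset_incl _ _ _ _ _ _ _ AB) ?big_seq_fset1 ?subrr ?cnorm0 //.
by move=> x _; rewrite inE => /h.
Qed.

(** A finite set whose partial sum is within e of the supremum leaves a remainder of at
    most e. *)
Lemma sums_tail u M (e : K) : (forall i, 0 <= u i) -> sums_le u M -> 0 < e ->
  exists A : {fset I}, sums_le (fun i => if i \in A then 0 else u i) e.
Proof.
move=> u0 hu e0.
pose E := [set \sum_(i <- A) u i | A in [set: {fset I}]].
have supE : has_sup E.
  split; first by exists 0; exists fset0; rewrite // big_seq_fset0.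
  by exists M => _ [A _ <-].
have [_ [A _ <-] hA] := sup_adherent e0 supE.
exists A => B.
have h1 : \sum_(i <- (A `|` B)%fset) u i <= sup E.
  by apply: sup_upper_bound => //; eexists.
rewrite (big_fsetID _ (mem A)) /= in h1.
rewrite (_ : [fset x in (A `|` B)%fset | x \in A]%fset = A) in h1; last first.
  by apply/fsetP => x; rewrite !inE /= andbC; case: (x \in A).
rewrite (big_fsetID _ (mem A)) /= big1_fset ?add0r; last first.
  by move=> i; rewrite !inE /= => /andP[_ ->].
rewrite (_ : [fset x in (A `|` B)%fset | x \notin A]%fset
  = [fset x in B | x \notin A]%fset) in h1; last first.
  by apply/fsetP => x; rewrite !inE /=; case: (x \in A); rewrite //= !andbF.
rewrite (eq_big_seq u); last by move=> i; rewrite !inE /= => /andP[_ /negbTE ->].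
by lra.
Qed.

End Sums.

(** *** Regrouping along a map with finite fibres *)
Section Fibres.
Variables (I J : choiceType) (phi : I -> J) (Fib : J -> {fset I}).
Hypothesis FibP : forall i j, i \in Fib j -> phi i = j.

(** Fib j is a finite part of the fibre of phi over j; different fibres are disjoint, so
    the sums over them add up to the sum over their union. *)
Lemma sum_fibres (V : nmodType) (f : I -> V) (B : {fset J}) :
  \sum_(j <- B) \sum_(i <- Fib j) f i = \sum_(i <- (\bigcup_(j <- B) Fib j)%fset) f i.
Proof.
rewrite (partition_big_imfset _ phi) /=.
rewrite (_ : \sum_(j <- B) _ = \sum_(j <- B) 
   \sum_(i <- (\bigcup_(j <- B) Fib j)%fset | phi i == j) f i).
  symmetry; apply: big_fset_incl.
    apply/fsubsetP => j /imfsetP[i /= /bigfcupP[k /andP[kB _] ik] ->].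
    by rewrite (FibP ik).
  move=> j jB jN; rewrite big1_seq // => i /andP[/eqP ij iU].
  by case/negP: jN; apply/imfsetP; exists i.
apply: eq_big_seq => j jB.
rewrite [RHS]big_fset_condE.
rewrite (_ : [fset i in _ | phi i == j]%fset = Fib j) //.
apply/fsetP => i; rewrite !inE /=; apply/andP/idP.
  by move=> [/bigfcupP[k _ ik] /eqP <-]; rewrite (FibP ik).
by move=> ij; rewrite (FibP ij) eqxx; split=> //; apply/bigfcupP; exists j; rewrite ?jB.
Qed.

(** The partial sum of g over B is the partial sum of f over the union of the fibres
    above B, and these unions exhaust the support of f. *)
Lemma has_sum_fibres (f : I -> C) (g : J -> C) l :
  (forall i, f i != 0 -> i \in Fib (phi i)) ->
  (forall j, g j = \sum_(i <- Fib j) f i) ->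
  has_sum f l -> has_sum g l.
Proof.
move=> supp hg hf e e0; have [A hA] := hf _ e0.
exists [fset phi i | i in A]%fset => B AB.
rewrite (eq_bigr _ (fun j _ => hg j)) sum_fibres.
set U := (\bigcup_(_ <- _) _)%fset.
rewrite (@big_fset_incl _ _ _ _ _ (U `|` A)%fset) ?fsubsetUl //.
  by apply: hA; rewrite fsubsetUr.
move=> i; rewrite inE => /orP[-> //|iA iU].
apply/eqP/negPn/negP => /supp ii; case/negP: iU.
apply/bigfcupP; exists (phi i) => //; rewrite andbT.
by apply: (fsubsetP AB); apply/imfsetP; exists i.
Qed.

Lemma sums_le_fibres (u : I -> K) (v : J -> K) M :
  (forall j, v j <= \sum_(i <- Fib j) u i) ->
  sums_le u M -> sums_le v M.
Proof.
move=> hv hu B; apply: le_trans (hu (\bigcup_(j <- B) Fib j)%fset).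
by rewrite -sum_fibres; apply: ler_sum.
Qed.

Lemma sums_le_of_fibres (u : I -> K) (v : J -> K) M :
  (forall i, 0 <= u i) ->
  (forall i, u i != 0 -> i \in Fib (phi i)) ->
  (forall j, \sum_(i <- Fib j) u i <= v j) ->
  sums_le v M -> sums_le u M.
Proof.
move=> u0 supp huv hv A.
pose B := [fset phi i | i in A]%fset.
apply: le_trans (hv B); apply: (@le_trans _ _ (\sum_(j <- B) \sum_(i <- Fib j) u i)).
  rewrite sum_fibres.
  set U := (\bigcup_(_ <- _) _)%fset.
  rewrite (@big_fset_incl _ _ _ _ U (U `|` A)%fset) ?fsubsetUl //.
    by apply: sum_fset_le; rewrite ?fsubsetUr.
  move=> i; rewrite inE => /orP[-> //|iA iU].
  apply/eqP/negPn/negP => /supp ii; case/negP: iU.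
  apply/bigfcupP; exists (phi i) => //; rewrite andbT.
  by apply/imfsetP; exists i.
by apply: ler_sum.
Qed.

End Fibres.

(** *** Products of sums *)
Section Products.
Variables I J : choiceType.

Lemma sum_fsetM (V : pzSemiRingType) (f : I -> V) (g : J -> V) (A : {fset I}) (B : {fset J}) :
  (\sum_(i <- A) f i) * (\sum_(j <- B) g j) =
  \sum_(p <- (A `*` B)%fset) f p.1 * g p.2.
Proof.
rewrite /fsetM big_imfset2 /=; last by move=> [? ?] [? ?] _ _ [-> ->].
rewrite big_distrl /=; apply: eq_bigr => i _.
by rewrite big_distrr.
Qed.

Lemma fset_sub_rect (A : {fset I * J}) :
  (A `<=` [fset p.1 | p in A] `*` [fset p.2 | p in A])%fset.
Proof.
apply/fsubsetP => p pA; rewrite in_fsetM.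
by apply/andP; split; apply/imfsetP; exists p.
Qed.

Lemma sums_leM (u : I -> K) (v : J -> K) M N :
  (forall i, 0 <= u i) -> (forall j, 0 <= v j) ->
  sums_le u M -> sums_le v N ->
  sums_le (fun p : I * J => u p.1 * v p.2) (M * N).
Proof.
move=> u0 v0 hu hv A.
apply: (@le_trans _ _ (\sum_(p <- ([fset p.1 | p in A] `*` [fset p.2 | p in A])%fset)
  u p.1 * v p.2)).
  by apply: sum_fset_le (fset_sub_rect A) => p; rewrite mulr_ge0.
by rewrite -sum_fsetM ler_pM ?sumr_ge0.
Qed.

Lemma abs_sums_leM (f : I -> C) (g : J -> C) M N : abs_sums_le f M -> abs_sums_le g N ->
  abs_sums_le (fun p : I * J => f p.1 * g p.2) (M * N).
Proof.
move=> hf hg; apply: sums_le_dom (sums_leM _ _ hf hg) => p /=;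
  by rewrite ?cnorm_ge0 ?cnormM.
Qed.

(** The family is absolutely summable, so its sum T is approximated by partial sums over
    large rectangles, which are products of partial sums of f and g. *)
Lemma has_sumM (f : I -> C) (g : J -> C) l m M N : abs_sums_le f M -> abs_sums_le g N ->
  has_sum f l -> has_sum g m -> has_sum (fun p : I * J => f p.1 * g p.2) (l * m).
Proof.
move=> hM hN hf hg; have [T hT] := has_sum_abs (abs_sums_leM hM hN).
suff -> : l * m = T by [].
apply/eqP; rewrite -subr_eq0; apply/eqP/cnorm_eq0.
apply/eqP; rewrite eq_le cnorm_ge0 andbT.
have M0 := sums_ge0 hM; have N0 := sums_ge0 hN.
have P0 : 0 < 1 + M + N by rewrite -addrA ltr_pwDl ?addr_ge0.
apply/ler_addgt0Pr => e e0; rewrite add0r.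
have e1 : 0 < e / (1 + M + N) by rewrite divr_gt0.
have [A hA] := hT _ e1; have [A1 hA1] := hf _ e1; have [A2 hA2] := hg _ e1.
have := hA ((A1 `|` [fset p.1 | p in A]) `*` (A2 `|` [fset p.2 | p in A]))%fset.
have := hA1 (A1 `|` [fset p.1 | p in A])%fset (fsubsetUl _ _).
have := hA2 (A2 `|` [fset p.2 | p in A])%fset (fsubsetUl _ _).
have := hM (A1 `|` [fset p.1 | p in A])%fset.
have := hN (A2 `|` [fset p.2 | p in A])%fset.
rewrite -sum_fsetM.
have := cnorm_sum (A1 `|` [fset p.1 | p in A])%fset f.
have := cnorm_sum (A2 `|` [fset p.2 | p in A])%fset g.
set F := \sum_(i <- _) f i; set G := \sum_(i <- _) g i.
move=> hG1 hF1 hG2 hF2 h1 h2 h3.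
have {h3}h3 : cnorm (F * G - T) < e / (1 + M + N).
  apply: h3; apply: fsubset_trans (fset_sub_rect A) _.
  apply/fsubsetP => p; rewrite !in_fsetM => /andP[p1 p2].
  by apply/andP; split; rewrite inE ?p1 ?p2 orbT.
have -> : l * m - T = (F * G - T) - (F - l) * G - l * (G - m) by ring.
have hl := has_sum_le hf hM.
rewrite (le_trans (cnormD _ _)) // cnormN.
have := cnormD (F * G - T) (- ((F - l) * G)).
rewrite cnormN !cnormM.
set d := e / _ in h1 h2 h3 *.
have -> : e = d + d * N + M * d by rewrite /d; field; rewrite gt_eqF.
have : cnorm (F - l) * cnorm G <= d * N.
  by rewrite ler_pM ?cnorm_ge0 ?(ltW h2) // (le_trans hG1).
have : cnorm l * cnorm (G - m) <= M * d.
  by rewrite ler_pM ?cnorm_ge0 ?(ltW h1).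
lra.
Qed.

End Products.

End UnorderedSums.

(** * Dirichlet series as functions of a complex variable *)

Section Interface.
Variable K : realType.
Local Notation C := (K[i]).
Local Notation cnorm := (@ComplexField.Normc.normc K).

Definition restr (I : choiceType) (D : set I) (f : I -> C) : I -> C :=
  fun i => if i \in D then f i else 0.

Lemma sum_restr (I : choiceType) (D : set I) (f : I -> C) (A : {fset I}) :
  \sum_(i <- A | i \in D) f i = \sum_(i <- A) restr D f i.
Proof. by rewrite big_mkcond. Qed.

Lemma sum_over_eq (I : choiceType) (D : set I) (f : I -> C) l :
  has_sum (restr D f) l -> sum_over D f = l.
Proof.
move=> h; rewrite /sum_over -[RHS](net_lim_lim h).
by under eq_fun do rewrite sum_restr.
Qed.

Lemma abs_convergentP (I : choiceType) (D : set I) (f : I -> C) :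
  abs_convergent D f <-> exists M, abs_sums_le (restr D f) M.
Proof.
rewrite /abs_convergent /summable.
have E i : (`|(complex.Re `|f i|)%:E| = (cnorm (f i))%:E)%E.
  by rewrite cnormE /= ger0_norm // cnorm_ge0.
under eq_esum do rewrite E.
split=> [h|[M hM]].
- have h0 : (0 <= \esum_(i in D) (cnorm (f i))%:E)%E.
    by apply: esum_ge0 => i _; rewrite lee_fin cnorm_ge0.
  exists (fine (\esum_(i in D) (cnorm (f i))%:E)%E) => A.
  rewrite -lee_fin fineK ?ge0_fin_numE //.
  apply: esum_ge; exists [set` [fset i in A | i \in D]%fset].
    split; first exact: finite_fset.
    by move=> i /=; rewrite !inE => /andP[_]; rewrite in_setE.
  rewrite fsbig_finite //= set_fsetK sumEFin lee_fin big_fset /=.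
  rewrite [leRHS]big_mkcond; apply: ler_sum => i _; rewrite /= /restr.
  by case: ifP; rewrite ?cnorm0.
- apply: (@le_lt_trans _ _ M%:E); last by rewrite ltry.
  apply: ge_ereal_sup => _ [F [finF FD] <-].
  rewrite fsbig_finite // sumEFin lee_fin (le_trans _ (hM (fset_set F))) //.
  rewrite le_eqVlt; apply/orP; left; apply/eqP; apply: eq_big_seq => i.
  rewrite in_fset_set // in_setE => /FD Di.
  by rewrite /= /restr mem_set.
Qed.

Lemma has_prodP (I : choiceType) (D : set I) (f : I -> C) l :
  has_prod D f l <-> net_lim (fun A : {fset I} => \prod_(i <- A | i \in D) f i) l.
Proof. exact: net_limP. Qed.

End Interface.

Section ComplexExp.
Variable K : realType.
Local Notation C := (K[i]).
Local Notation cnorm := (@ComplexField.Normc.normc K).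

Lemma cexpD (z w : C) : cexp (z + w) = cexp z * cexp w.
Proof.
case: z => a b; case: w => c d; rewrite /cexp /= expRD cosD sinD.
apply/eqP; rewrite eq_complex /= !(mul0r, subr0, addr0, mulr0, add0r) .
by apply/andP; split; apply/eqP; ring.
Qed.

Lemma cexp0 : cexp (0 : C) = 1.
Proof. by rewrite /cexp /= expR0 cos0 sin0 mul1r. Qed.

Lemma cnorm_cexp (z : C) : cnorm (cexp z) = expR (complex.Re z).
Proof.
by rewrite cnormM cnorm_real /= cos2Dsin2 sqrtr1 mulr1 ger0_norm // expR_ge0.
Qed.

Lemma sin_mvt (y : K) : 0 <= y -> exists2 c, 0 <= c <= y & sin y = cos c * y.
Proof.
move=> y0; have [|c] := @MVT_segment K sin cos 0 y y0.
  exact/continuous_subspaceT/continuous_sin.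
by rewrite in_itv /= sin0 !subr0 => h e; exists c.
Qed.

Lemma cos_mvt (y : K) : 0 <= y -> exists2 c, 0 <= c <= y & cos y - 1 = - sin c * y.
Proof.
move=> y0; have [|c] := @MVT_segment K cos (fun x => - sin x) 0 y y0.
  exact/continuous_subspaceT/continuous_cos.
by rewrite in_itv /= cos0 subr0 => h e; exists c.
Qed.

(** A bound of order two is all that differentiability needs; the two trigonometric ones
    follow from the mean value theorem applied twice. *)
Lemma cos_sub_le (y : K) : `|cos y - 1| <= y ^+ 2.
Proof.
wlog y0 : y / 0 <= y.
  move=> h; have [/h//|/ltW y0] := leP 0 y.
  by rewrite -cosN -sqrrN h // oppr_ge0.
have [c /andP[c0 cy] ->] := cos_mvt y0; have [d _ ->] := sin_mvt c0.
rewrite normrM normrN normrM expr2 (ger0_norm y0) (ger0_norm c0).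
rewrite ler_wpM2r // (le_trans _ cy) // ler_piMl // ler_norml.
by rewrite cos_le1 cos_geN1.
Qed.

Lemma sin_sub_le (y : K) : `|sin y - y| <= y ^+ 2.
Proof.
wlog y0 : y / 0 <= y.
  move=> h; have [/h//|/ltW y0] := leP 0 y.
  by have := h (- y); rewrite oppr_ge0 sinN -opprD normrN sqrrN; apply.
have [c /andP[c0 cy] ->] := sin_mvt y0; have [d _ e] := cos_mvt c0.
rewrite -{2}(mul1r y) -mulrBl normrM e expr2 (ger0_norm y0) ler_wpM2r //.
rewrite normrM normrN (ger0_norm c0) (le_trans _ cy) // ler_piMl // ler_norml.
by rewrite sin_le1 sin_geN1.
Qed.

Lemma expR_sub1_le (x : K) : `|expR x - 1| <= `|x| * expR `|x|.
Proof.
have h1 := expR_ge1Dx x; have h2 := expR_ge1Dx (- x).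
have ex := expR_gt0 x; have E : expR x * expR (- x) = 1 by rewrite -expRD subrr expR0.
have [x0|x0] := leP 0 x.
  by rewrite !ger0_norm //; [nra | lra].
rewrite !ler0_norm ?(ltW x0) //; [nra | by rewrite subr_le0 -expR0 ler_expR ltW].
Qed.

Lemma expR_sub1x_le (x : K) : `|expR x - 1 - x| <= x ^+ 2 * expR `|x|.
Proof.
have h1 := expR_ge1Dx x; have h2 := expR_ge1Dx (- x).
have ex := expR_gt0 x; have E : expR x * expR (- x) = 1 by rewrite -expRD subrr expR0.
rewrite ger0_norm; last by lra.
apply: (@le_trans _ _ (x * (expR x - 1))); first by nra.
apply: le_trans (ler_norm _) _; rewrite normrM -real_normK ?num_real // expr2 -mulrA.
by rewrite ler_wpM2l // expR_sub1_le.
Qed.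

(** For z = x + iy the remainder is
    e^x (e^(iy) - 1 - iy) + (e^x - 1 - x) + iy (e^x - 1). *)
Lemma cexp_taylor1 (z : C) :
  cnorm (cexp z - 1 - z) <= 5 * cnorm z ^+ 2 * expR (cnorm z).
Proof.
case: z => x y; set z := x +i* y.
have hx : `|x| <= cnorm z := cnormRe z.
have hy : `|y| <= cnorm z := cnormIm z.
have N0 := cnorm_ge0 z; set N := cnorm z in hx hy N0 *.
have -> : cexp z - 1 - z = (expR x)%:C * ((cos y - 1) +i* (sin y - y))
    + (expR x - 1 - x)%:C + ((expR x - 1) * y)%:C * 'i%C.
  by apply/eqP; rewrite eq_complex /=; apply/andP; split; apply/eqP; ring.
have tri (a b : K) : cnorm (a +i* b) <= `|a| + `|b|.
  have -> : a +i* b = a%:C + b%:C * 'i%C.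
    by apply/eqP; rewrite eq_complex /=; apply/andP; split; apply/eqP; ring.
  rewrite (le_trans (cnormD _ _)) // cnormM !cnorm_real.
  by rewrite /= expr0n expr1n add0r sqrtr1 mulr1.
have ni : cnorm 'i%C = 1 by rewrite /= expr0n expr1n add0r sqrtr1.
rewrite (le_trans (cnormD _ _)) // cnormM ni mulr1 cnorm_real.
have := cnormD ((expR x)%:C * ((cos y - 1) +i* (sin y - y))) (expR x - 1 - x)%:C.
rewrite cnormM !cnorm_real (ger0_norm (expR_ge0 x)).
have hE : expR x <= expR N by rewrite ler_expR (le_trans _ hx) // ler_norm.
have hE' : expR `|x| <= expR N by rewrite ler_expR.
have N2 : 0 <= N ^+ 2 by rewrite sqr_ge0.
have y2 : y ^+ 2 <= N ^+ 2 by rewrite -real_normK ?num_real // ler_sqr ?nnegrE.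
have x2 : x ^+ 2 <= N ^+ 2 by rewrite -real_normK ?num_real // ler_sqr ?nnegrE.
have t1 : expR x * cnorm ((cos y - 1) +i* (sin y - y)) <= expR N * (2 * N ^+ 2).
  rewrite ler_pM ?expR_ge0 ?cnorm_ge0 // (le_trans (tri _ _)) //.
  by have := cos_sub_le y; have := sin_sub_le y; lra.
have t2 : `|expR x - 1 - x| <= N ^+ 2 * expR N.
  by rewrite (le_trans (expR_sub1x_le _)) // ler_pM ?sqr_ge0 ?expR_ge0.
have t3 : `|(expR x - 1) * y| <= N ^+ 2 * expR N.
  rewrite normrM (le_trans (ler_pM _ _ (expR_sub1_le x) hy)) //.
  by rewrite mulrAC ler_pM ?mulr_ge0 ?expR_ge0 // expr2 ler_wpM2r.
have eN := expR_gt0 N.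
have : 0 <= N ^+ 2 * expR N by rewrite mulr_ge0 // ltW.
lra.
Qed.

End ComplexExp.

Section Derivative.
Variable K : realType.
Local Notation C := (K[i]).
Local Notation cnorm := (@ComplexField.Normc.normc K).

Lemma cnorm_dirichlet_term (c : K -> C) (s : C) (r : K) :
  cnorm (dirichlet_term c s r) = cnorm (c r) * expR (- complex.Re s * r).
Proof.
rewrite cnormM cnorm_cexp; congr (_ * expR _).
by case: s => a b; rewrite /= mulr0 subr0.
Qed.

Lemma restrT (I : choiceType) (f : I -> C) : restr setT f = f.
Proof. by apply/funext => i; rewrite /restr in_setT. Qed.

Lemma dirichlet_has_sum (c : K -> C) s M : abs_sums_le (dirichlet_term c s) M ->
  has_sum (dirichlet_term c s) (dirichlet c s).
Proof.
move=> /has_sum_abs[l h]; suff -> : dirichlet c s = l by [].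
by apply: sum_over_eq; rewrite restrT.
Qed.

Lemma dirichlet_abs_mono (c : K -> C) (s0 s : C) M :
  (forall r, r < 0 -> c r = 0) -> complex.Re s0 <= complex.Re s ->
  abs_sums_le (dirichlet_term c s0) M -> abs_sums_le (dirichlet_term c s) M.
Proof.
move=> c0 le; apply: sums_le_dom => r /=.
rewrite !cnorm_dirichlet_term; have [r0|r0] := ltP r 0.
  by rewrite c0 // cnorm0 !mul0r.
by rewrite ler_wpM2l ?cnorm_ge0 // ler_expR; nra.
Qed.

(** The factor r^2 of the second-order remainder is absorbed by moving the exponent of
    convergence by d. *)
Lemma sqr_le_expR (d r : K) : 0 < d -> 0 <= r -> r ^+ 2 <= 4 / d ^+ 2 * expR (d * r).
Proof.
move=> d0 r0.
have -> : expR (d * r) = expR (d * r / 2) ^+ 2.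
  by rewrite -expRM_natl; congr expR; field.
have h := expR_ge1Dx (d * r / 2).
have h' : 0 <= d * r / 2 by rewrite divr_ge0 ?mulr_ge0 // ltW.
have -> : r ^+ 2 = 4 / d ^+ 2 * (d * r / 2) ^+ 2 by field; rewrite gt_eqF.
rewrite ler_wpM2l ?divr_ge0 ?sqr_ge0 // ler_sqr ?nnegrE ?expR_ge0 //.
by lra.
Qed.

(** With h the increment, the term of exponent r contributes an error of at most
    5 |h|^2 r^2 e^(|h| r) times its modulus at s.  For |h| at most half the distance from
    s to the line Re = s0 this is O(|h|^2) times its modulus at s0, so the errors sum
    up to O(|h|^2).  Only nonnegative exponents occur, hence moduli decrease to the
    right. *)
Lemma dirichlet_derivable (c : K -> C) (s0 : K) (s : C) M :
  (forall r, r < 0 -> c r = 0) ->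
  abs_sums_le (dirichlet_term c s0%:C) M -> s0 < complex.Re s ->
  derivable (dirichlet c : C^o -> C^o) s 1.
Proof.
move=> cneg hM lt.
pose d := (complex.Re s - s0) / 2.
have d0 : 0 < d by rewrite divr_gt0 // subr_gt0.
pose g (r : K) := dirichlet_term c s r * r%:C.
pose E := 4 / d ^+ 2.
have E0 : 0 <= E by rewrite divr_ge0 ?sqr_ge0.
have M0 := sums_ge0 hM.
have key (r t : K) : t <= d -> cnorm (c r) * (r ^+ 2 * expR (- (complex.Re s - t) * r)) <=
    E * cnorm (dirichlet_term c s0%:C r).
  move=> td; rewrite cnorm_dirichlet_term /=; have [r0|r0] := ltP r 0.
    by rewrite cneg // cnorm0 !mul0r mulr0.
  rewrite [leRHS]mulrCA ler_wpM2l ?cnorm_ge0 //.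
  apply: le_trans (ler_wpM2r (expR_ge0 _) (sqr_le_expR d0 r0)) _.
  rewrite -/E -mulrA ler_wpM2l // -expRD ler_expR.
  have : 0 <= (d - t) * r by rewrite mulr_ge0 // subr_ge0.
  have -> : s0 = complex.Re s - 2 * d by rewrite /d; field.
  by move=> ?; lra.
have [G hG] : exists G, has_sum g G.
  apply: (@has_sum_abs _ _ _ (M + E * M)).
  apply: sums_le_dom (sums_leD hM (sums_leZ E0 hM)) => r /=.
  rewrite /g cnormM cnorm_real.
  have := key r 0 (ltW d0); rewrite subr0.
  have [r0|r0] := ltP r 0.
    by rewrite !cnorm_dirichlet_term cneg // cnorm0 !mul0r mulr0 addr0.
  have h1 : r <= 1 + r ^+ 2 by have := sqr_ge0 (r - 1); nra.
  have h0 : cnorm (dirichlet_term c s r) <= cnorm (dirichlet_term c s0%:C r).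
    rewrite !cnorm_dirichlet_term ler_wpM2l ?cnorm_ge0 // ler_expR /=; nra.
  rewrite ger0_norm //.
  have N0 := cnorm_ge0 (dirichlet_term c s r).
  move: h0 N0; rewrite [cnorm (dirichlet_term c s r)]cnorm_dirichlet_term.
  set w := expR _; move=> h0 N0 h2.
  apply: le_trans (ler_wpM2l N0 h1) _; nra.
(* The derivative at s is the opposite of G, the sum of r c(r) e^(-s r). *)
have main (h : C) : cnorm h <= d ->
    cnorm (dirichlet c (s + h) - dirichlet c s + h * G) <= 5 * cnorm h ^+ 2 * (E * M).
  move=> hd.
  have Reh : - d <= complex.Re h.
    have := cnormRe h; rewrite ler_norml => /andP[h1 _]; lra.
  have Resh : s0 <= complex.Re (s + h).
    rewrite raddfD /=; rewrite /d in Reh; lra.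
  have h1 := dirichlet_has_sum (@dirichlet_abs_mono c s0%:C _ M cneg Resh hM).
  have h2 := dirichlet_has_sum (@dirichlet_abs_mono c s0%:C _ M cneg (ltW lt) hM).
  have := has_sumD (has_sumD h1 (has_sumN h2)) (has_sumZ h hG) => /has_sum_le; apply.
  have N2 : 0 <= 5 * cnorm h ^+ 2 by rewrite mulr_ge0 // sqr_ge0.
  apply: sums_le_dom (sums_leZ N2 (sums_leZ E0 hM)) => r /=.
  have -> : dirichlet_term c (s + h) r - dirichlet_term c s r + h * g r =
     dirichlet_term c s r * (cexp (- h * r%:C) - 1 - (- h * r%:C)).
    by rewrite /g /dirichlet_term opprD mulrDl cexpD; ring.
  rewrite cnormM; have [r0|r0] := ltP r 0.
    by rewrite !cnorm_dirichlet_term cneg // cnorm0 !mul0r !mulr0.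
  apply: le_trans (ler_wpM2l (cnorm_ge0 _) (cexp_taylor1 _)) _.
  rewrite (cnormM (- h)) cnormN cnorm_real (ger0_norm r0) cnorm_dirichlet_term.
  apply: le_trans (ler_wpM2l N2 (key r _ hd)).
  rewrite le_eqVlt; apply/orP; left; apply/eqP.
  have -> : - (complex.Re s - cnorm h) * r = - complex.Re s * r + cnorm h * r by ring.
  by rewrite expRD; ring.
rewrite /derivable; apply/cvg_ex; exists (- G : C^o).
apply/cvgrPdist_lt => e; rewrite ltcE => /andP[/eqP Ie Re0].
pose B := 5 * (E * M).
have B0 : 0 <= B by apply: mulr_ge0 => //; apply: mulr_ge0.
pose dl := Num.min d (complex.Re e / (B + 1)).
have dl0 : 0 < dl by rewrite lt_min d0 divr_gt0 // ltr_wpDl.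
have dlC : (0 : C) < dl%:C by rewrite ltcR.
apply/nbhs_ballP; exists dl%:C => // h /=; rewrite -ball_normE /= sub0r normrN => hb h0.
have {}hb : cnorm h < dl by move: hb; rewrite cnormE ltcR.
have hn0 : 0 < cnorm h.
  rewrite lt_neqAle cnorm_ge0 andbT eq_sym; apply/eqP => /cnorm_eq0 hh.
  by move: h0; rewrite hh eqxx.
have hd : cnorm h <= d by rewrite ltW // (lt_le_trans hb) // ge_min lexx.
have hM' := main h hd.
have -> : - G - h^-1 *: (dirichlet c (h *: 1 + s) - dirichlet c s : C^o) =
   - (h^-1 * (dirichlet c (s + h) - dirichlet c s + h * G)).
  rewrite [h *: 1](_ : _ = h); last exact: mulr1.
  rewrite [_ *: _](_ : _ = h^-1 * (dirichlet c (h + s) - dirichlet c s)) //.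
  rewrite (addrC h) [in RHS]mulrDr.
  by rewrite (mulKf h0) opprD; exact: addrC.
rewrite cnormE cnormN cnormM ltcE /= Ie eqxx /=.
rewrite ComplexField.Normc.normcV mulrC ltr_pdivrMr //.
apply: le_lt_trans hM' _.
have : cnorm h < complex.Re e / (B + 1) by rewrite (lt_le_trans hb) // ge_min lexx orbT.
rewrite ltr_pdivlMr ?ltr_wpDl // => h5.
rewrite (_ : 5 * _ * _ = B * cnorm h * cnorm h); last by rewrite /B; ring.
by rewrite ltr_pM2r //; nra.
Qed.

End Derivative.

(** * The growth series as a product of zeta functions *)

Section Fibration.
Variable R : idomainType.
Hypothesis R_pid : is_PID R.
Hypothesis R_fin : residue_finite R.
Variable n : nat.

Definition tri (d : R) (w : 'rV[R]_n) (X : 'M[R]_n) : 'M[R]_(1 + n) :=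
  block_mx d%:M w 0 X.

Lemma det_tri d w X : \det (tri d w X) = d * \det X.
Proof. by rewrite /tri det_ublock det_scalar1. Qed.

Lemma nonsing_tri d w X : nonsing (tri d w X) <-> d != 0 /\ nonsing X.
Proof. by rewrite /nonsing /= det_tri mulf_eq0 negb_or; split=> [/andP|[-> ->]]. Qed.

(** An invertible matrix carrying one nonsingular block triangular matrix to another is
    block triangular, since X kills only 0.  If moreover the diagonal blocks agree, it has
    identity diagonal blocks, and adds to w a multiple of d. *)
Lemma tri_lassoc d w X d1 w1 X1 : d != 0 -> nonsing X ->
  lassoc (tri d w X) (tri d1 w1 X1) ->
  [/\ exists2 u, u \is a GRing.unit & d1 = d * u, lassoc X X1 &
   d1 = d -> X1 = X -> forall j, rdvd d (w1 0 j - w 0 j)].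
Proof.
move=> d0 X0 /lassocP[|U Uu]; first exact/nonsing_tri.
rewrite -[U](@submxK _ 1 n 1 n) mulmx_block !mul0mx !add0r => /eq_block_mx[hd hw h0 hX].
have b0 : dlsubmx U = 0 by apply: (nonsing_inj X0); rewrite mulmx0.
move: hd hw; rewrite b0 mulmx0 addr0 => hd hw.
have : U \in unitmx by [].
rewrite -{1}[U](@submxK _ 1 n 1 n) b0 unitmxE det_ublock unitrM det_mx11 => /andP[uu Cu].
split.
- exists (ulsubmx U 0 0) => //.
  have /matrixP/(_ 0 0) := hd; rewrite [ulsubmx U]mx11_scalar -scalar_mxM !mxE.
  by rewrite !eqxx !mulr1n.
- by apply/lassocP => //; exists (drsubmx U); rewrite // unitmxE.
move=> dd XX j.
have C1 : drsubmx U = 1%:M by apply: (nonsing_inj X0); rewrite mulmx1 -hX.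
rewrite hw C1 mulmx1 mul_scalar_mx !mxE addrK.
exact: rdvd_mulr.
Qed.

Definition residue_reps (d : R) : seq R := xget [::] [set s | res_system d s].

Lemma residue_repsP d : d != 0 -> res_system d (residue_reps d).
Proof.
by move=> /(res_system_exists R_fin)[s hs]; rewrite /residue_reps; case: xgetP => [_ _ //|/(_ s)[]].
Qed.

Definition row_of d (f : {ffun 'I_n -> 'I_(size (residue_reps d))}) : 'rV[R]_n :=
  \row_j nth 0 (residue_reps d) (f j).

Definition index_pair := (set R * set 'M[R]_n)%type.

Definition tri_class (p : index_pair) (f : {ffun 'I_n -> 'I_(size (residue_reps (xget 0 p.1)))}) :=
  lclass (tri (xget 0 p.1) (row_of f) (class_rep p.2)).

Definition good_pair (p : index_pair) :=
  `[< @nonzero_classes R p.1 /\ @lclasses R n p.2 >].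

(** The lattices over the pair p: the chosen representatives of the two classes are
    completed by all rows w with entries in a residue system modulo d. *)
Definition tri_fibre (p : index_pair) : {fset set 'M[R]_(1 + n)} :=
  if good_pair p then [fset @tri_class p f | f in predT]%fset else fset0.

Lemma nonzero_classesP c : @nonzero_classes R c ->
  xget 0 c != 0 /\ assoc_class (xget 0 c) = c.
Proof.
move=> [a a0 <-]; have [u uu h] := assoc_rep a; rewrite h; split.
  by rewrite mulf_neq0 //; apply: contraTneq uu => ->; rewrite unitr0.
by symmetry; apply/assoc_classP; exists u.
Qed.

Lemma tri_class_inj p : good_pair p -> injective (@tri_class p).
Proof.
move=> /asboolP[/nonzero_classesP[d0 _] /class_repP[X0 _]] f g /lclassP.
move=> /(tri_lassoc d0 X0)[_ _ /(_ erefl erefl) h].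
apply/ffunP => j; have := h j; rewrite !mxE => hj.
have [us _ inc] := residue_repsP d0.
have /eqP := inc _ _ (mem_nth 0 (ltn_ord (g j))) (mem_nth 0 (ltn_ord (f j))) hj.
by rewrite nth_uniq // => /eqP e; apply/val_inj.
Qed.

Lemma card_tri_fibre p : good_pair p -> #|` tri_fibre p|%fset = (class_norm p.1 ^ n)%N.
Proof.
move=> gp; rewrite /tri_fibre gp card_imfset //=; last exact: tri_class_inj.
rewrite -cardE card_ffun !card_ord; congr (_ ^ _)%N.
have /asboolP[/nonzero_classesP[d0 _] _] := gp.
by rewrite /class_norm (res_system_norm (residue_repsP d0)).
Qed.

Lemma tri_fibreP c p : c \in tri_fibre p ->
  good_pair p /\ exists f, c = @tri_class p f.
Proof.
by rewrite /tri_fibre; case: ifP => // gp /imfsetP[f _ ->]; split=> //; exists f.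
Qed.

Lemma tri_fibre_norm c p : c \in tri_fibre p ->
  @lclasses R (1 + n) c /\ class_mnorm c = (class_norm p.1 * class_mnorm p.2)%N.
Proof.
move=> /tri_fibreP[/asboolP[/nonzero_classesP[d0 _] /class_repP[X0 _]] [f ->]].
have T0 : nonsing (tri (xget 0 p.1) (row_of f) (class_rep p.2)) by exact/nonsing_tri.
split; first by exists (tri (xget 0 p.1) (row_of f) (class_rep p.2)).
rewrite class_mnorm_lclass // /mnorm det_tri absnormM //.
Qed.

Lemma tri_fibre_disjoint c p q : c \in tri_fibre p -> c \in tri_fibre q -> p = q.
Proof.
move=> /tri_fibreP[/asboolP[/nonzero_classesP[d0 dd] /class_repP[X0 XX]] [f ->]].
move=> /tri_fibreP[/asboolP[/nonzero_classesP[e0 ee] /class_repP[Y0 YY]] [g]].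
move=> /lclassP/(tri_lassoc d0 X0)[h1 h2 _].
case: p q dd XX ee YY {f g d0 e0 X0 Y0} h1 h2 => [p1 p2] [q1 q2] /= dd XX ee YY h1 h2.
by rewrite -dd -ee -XX -YY; congr pair; [exact/assoc_classP | exact/lclassP].
Qed.

Lemma lclass_unit (X U : 'M[R]_(1 + n)) : nonsing X -> U \in unitmx -> lclass X = lclass (X *m U).
Proof. by move=> X0 Uu; apply/lclassP/lassocP => //; exists U. Qed.

(** After [triangularize], a block diagonal matrix replaces the diagonal blocks by the
    chosen representatives, and a unipotent one reduces the entries of w modulo d. *)
Lemma tri_fibre_cover c : @lclasses R (1 + n) c -> exists p, c \in tri_fibre p.
Proof.
move=> [X X0 <-]; have [U Uu [d0 [w0 [Y hU]]]] := triangularize R_pid X0.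
have : nonsing (X *m U) by apply/nonsingM; split=> //; exact: nonsing_unit.
rewrite hU => T0; have [d00 Y0] := (nonsing_tri _ _ _).1 T0.
rewrite (lclass_unit X0 Uu) hU.
have [u uu hu] := assoc_rep d0.
have /(lassocP _ Y0)[V Vu hV] := class_rep_lclass Y.
pose d := xget 0 (assoc_class d0); pose Z := class_rep (lclass Y).
have Wu : (block_mx u%:M 0 0 V : 'M[R]_(1 + n)) \in unitmx.
  by rewrite unitmxE det_ublock det_scalar1 unitrM uu -unitmxE.
have E1 : block_mx d0%:M w0 0 Y *m block_mx u%:M 0 0 V = tri d (w0 *m V) Z.
  by rewrite mulmx_block !(mulmx0, mul0mx, addr0, add0r) -scalar_mxM -hu -hV.
have gp : good_pair (assoc_class d0, lclass Y).
  by apply/asboolP; split; [exists d0 | exists Y].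
have dn0 : d != 0 by have /asboolP[/nonzero_classesP[]] := gp.
have [us cov inc] := residue_repsP dn0.
have /choice[a ha] j : exists a : R, exists k : 'I_(size (residue_reps d)),
    (w0 *m V) 0 j + d * a = nth 0 (residue_reps d) k.
  have [r rs [b hb]] := cov ((w0 *m V) 0 j).
  exists (- b); have kr : (index r (residue_reps d) < size (residue_reps d))%N by rewrite index_mem.
  by exists (Ordinal kr); rewrite /= nth_index // mulrN -hb; ring.
have /choice[f hf] := ha.
have Au : (block_mx 1%:M (\row_j a j) 0 1%:M : 'M[R]_(1 + n)) \in unitmx.
  by rewrite unitmxE det_ublock !det1 mulr1 unitr1.
exists (assoc_class d0, lclass Y); rewrite /tri_fibre gp.
apply/imfsetP; exists [ffun j => f j] => //=.
rewrite /tri_class /= -/d -/Z (lclass_unit T0 Wu) E1.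
have T1 : nonsing (tri d (w0 *m V) Z).
  by rewrite -E1; apply/nonsingM; split=> //; exact: nonsing_unit.
rewrite (lclass_unit T1 Au) /tri mulmx_block !(mulmx0, mul0mx, mulmx1, addr0, add0r).
congr (lclass (block_mx _ _ _ _)); move: (w0 *m V) hf => q hf.
apply/matrixP => i j; by rewrite mul_scalar_mx !ord1 [LHS]mxE addrC mxE mxE hf mxE ffunE.
Qed.

Definition tri_pair (c : set 'M[R]_(1 + n)) : index_pair :=
  xget (set0, set0) [set p | c \in tri_fibre p].

Lemma tri_pairP c p : c \in tri_fibre p -> tri_pair c = p.
Proof.
move=> h; rewrite /tri_pair; case: xgetP => [q _ hq|/(_ p)//].
exact: tri_fibre_disjoint hq h.
Qed.

Lemma tri_pair_mem c : @lclasses R (1 + n) c -> c \in tri_fibre (tri_pair c).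
Proof. by move=> /tri_fibre_cover[p hp]; rewrite (tri_pairP hp). Qed.

End Fibration.

Section Growth.
Variable K : realType.
Local Notation C := (K[i]).
Local Notation cnorm := (@ComplexField.Normc.normc K).

Lemma npowM (a b : nat) (s : C) : (0 < a)%N -> (0 < b)%N ->
  npow (a * b) s = npow a s * npow b s.
Proof.
move=> a0 b0; rewrite /npow natrM lnM ?posrE ?ltr0n //.
by rewrite -cexpD -mulrDr -rmorphD.
Qed.

Lemma npow1 (s : C) : npow 1 s = 1.
Proof. by rewrite /npow ln1 mulr0 cexp0. Qed.

Lemma npowD (a : nat) (s t : C) : npow a (s + t) = npow a s * npow a t.
Proof. by rewrite /npow mulrDl cexpD. Qed.

(** This turns the number N(d)^n of lattices over a pair into the shift from s to s - n. *)
Lemma npow_nat (a k : nat) : (0 < a)%N -> npow a (k%:R : C) = (a ^ k)%:R.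
Proof.
move=> a0; elim: k => [|k IH]; first by rewrite /npow mul0r cexp0.
rewrite -natr1 npowD IH expnSr natrM; congr (_ * _).
rewrite /npow mul1r /cexp /= cos0 sin0 mulr1 lnK ?posrE ?ltr0n //.
by rewrite rmorph_nat.
Qed.

Lemma cnorm_npow (a : nat) (s : C) : cnorm (npow a s) = expR (complex.Re s * ln a%:R).
Proof.
by rewrite cnorm_cexp; congr expR; case: s => x y /=; rewrite mulr0 subr0.
Qed.

Variable R : idomainType.
Hypothesis R_pid : is_PID R.
Hypothesis R_fin : residue_finite R.

Definition class_summand n (s : C) : set 'M[R]_n -> C :=
  restr (@lclasses R n) (fun c => npow (class_mnorm c) (- s)).

Definition zeta_summand (s : C) : set R -> C := restr (@nonzero_classes R) (zeta_term s).

Lemma class_norm_gt0 c : @nonzero_classes R c -> (0 < class_norm c)%N.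
Proof. by move=> /nonzero_classesP[h _]; exact: absnorm_gt0. Qed.

(** The fibre has N(d)^n members, all of norm N(d) N(det X). *)
Lemma tri_fibre_sum n s (p : index_pair R n) :
  \sum_(c <- tri_fibre p) class_summand s c = zeta_summand (s - n%:R) p.1 * class_summand s p.2.
Proof.
have [gp|gp] := boolP (good_pair p); last first.
  rewrite /tri_fibre (negbTE gp) big_seq_fset0.
  rewrite /zeta_summand /class_summand /restr; case: ifP; rewrite ?mul0r // => h1.
  case: ifP; rewrite ?mulr0 // => h2.
  by case/negP: gp; apply/asboolP; rewrite !in_setE in h1 h2.
have /asboolP[z1 z2] := gp.
rewrite (eq_big_seq (fun=> npow (class_norm p.1 * class_mnorm p.2) (- s))); last first.
  move=> c /(tri_fibre_norm R_fin)[h1 h2].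
  by rewrite /class_summand /restr mem_set // h2.
rewrite big_const_seq count_predT iter_addr_0 (card_tri_fibre R_fin gp).
rewrite /zeta_summand /class_summand /restr !mem_set // /zeta_term.
have n1 := class_norm_gt0 z1; have n2 := class_mnorm_gt0 R_fin z2.
rewrite npowM // opprB npowD npow_nat // -mulr_natl; ring.
Qed.

Lemma tri_fibre_cnorm_sum n s (p : index_pair R n) :
  \sum_(c <- tri_fibre p) cnorm (class_summand s c) =
    cnorm (zeta_summand (s - n%:R) p.1 * class_summand s p.2).
Proof.
rewrite -tri_fibre_sum.
have [gp|gp] := boolP (good_pair p); last first.
  by rewrite /tri_fibre (negbTE gp) !big_seq_fset0 cnorm0.
pose v : C := npow (class_norm p.1 * class_mnorm p.2) (- s).
have E c : c \in tri_fibre p -> class_summand s c = v.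
  move=> /(tri_fibre_norm R_fin)[h1 h2].
  by rewrite /class_summand /restr mem_set // h2.
rewrite (eq_big_seq _ E) (eq_big_seq _ (fun c cp => congr1 cnorm (E c cp))).
rewrite !big_const_seq !iter_addr_0 -[in RHS]mulr_natl cnormM cnorm_natr.
by rewrite mulr_natl.
Qed.

Variable sigma_a : K.
Hypothesis zeta_cvg : forall s : C, sigma_a < complex.Re s ->
       abs_convergent (@nonzero_classes R) (zeta_term s).

Lemma zeta_has_sum s : sigma_a < complex.Re s ->
  (exists M, abs_sums_le (zeta_summand s) M) /\ has_sum (zeta_summand s) (zeta R s).
Proof.
move=> /zeta_cvg/abs_convergentP[M hM]; split; first by exists M.
have [l hl] := has_sum_abs hM.
by rewrite /zeta (sum_over_eq hl).
Qed.

(** Summing over the fibres of the map to pairs, the series in size 1 + n is the product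
    of zeta(s - n) and the series in size n. *)
Lemma growth_has_sum n (s : C) : (forall i : 'I_n, sigma_a < complex.Re (s - i%:R)) ->
  (exists M, abs_sums_le (@class_summand n s) M) /\
  has_sum (@class_summand n s) (\prod_(i < n) zeta R (s - i%:R)).
Proof.
elim: n => [|n IH] hs.
  have E (c : set 'M[R]_0) : c \in @lclasses R 0 -> c = lclass 1%:M.
    rewrite in_setE => -[X _ <-]; congr lclass; apply/matrixP; by case.
  have T1 : class_summand s (lclass (1%:M : 'M[R]_0)) = 1.
    rewrite /class_summand /restr mem_set; last by exists 1%:M => //; exact: nonsing1.
    by rewrite class_mnorm_lclass ?/mnorm ?det1 ?absnorm1 ?npow1 //; exact: nonsing1.
  have E0 (c : set 'M[R]_0) : c != lclass 1%:M -> class_summand s c = 0.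
    move=> cn; rewrite /class_summand /restr; case: ifP => // cC.
    by move: (E _ cC) cn => ->; rewrite eqxx.
  split; last by rewrite big_ord0 -T1; exact: has_sum1.
  exists 1 => A; have [iA|iA] := boolP (lclass (1%:M : 'M[R]_0) \in A).
    rewrite (big_fsetD1 (lclass (1%:M : 'M[R]_0))) //= T1 cnorm1 big1_fset ?addr0 // => c.
    by rewrite in_fsetD1 => /andP[/E0 -> _]; rewrite cnorm0.
  rewrite big1_fset // => c cA _; rewrite /= E0 ?cnorm0 //.
  by apply: contraNneq iA => <-.
have [|[M hM] hP] := IH.
  by move=> i; exact: (hs (widen_ord (leqnSn n) i)).
have [[M' hM'] hZ] := zeta_has_sum (hs ord_max).
have hpair := has_sumM hM' hM hZ hP.
have habs := abs_sums_leM hM' hM.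
have supp (c : set 'M[R]_n.+1) : class_summand s c != 0 -> c \in tri_fibre (tri_pair c).
  rewrite /class_summand /restr; case: ifP; rewrite ?eqxx // in_setE => h _.
  exact: tri_pair_mem.
have hA : abs_sums_le (@class_summand n.+1 s) (M' * M).
  apply: (@sums_le_of_fibres K _ _ (@tri_pair R n) (@tri_fibre R n) _ _ _ _ _ _ _ habs).
  - by move=> c p; exact: tri_pairP.
  - by move=> c; exact: cnorm_ge0.
  - move=> c /= h; apply: supp; apply: contra_neq h => ->; exact: cnorm0.
  - by move=> p; rewrite [leLHS]tri_fibre_cnorm_sum.
split; first by exists (M' * M).
have [l hl] := has_sum_abs hA.
have hl' : has_sum (fun p : index_pair R n => zeta_summand (s - n%:R) p.1 * class_summand s p.2) l.
  apply: (@has_sum_fibres K _ _ (@tri_pair R n) (@tri_fibre R n) _ _ _ _ _ _ hl) => //.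
  - by move=> c p; exact: tri_pairP.
  - by move=> p; rewrite tri_fibre_sum.
rewrite big_ord_recr /= mulrC.
by rewrite (has_sum_unique hpair hl').
Qed.

End Growth.

(** * The Euler product of the zeta function *)

Section Euler.
Variable K : realType.
Local Notation C := (K[i]).
Local Notation cnorm := (@ComplexField.Normc.normc K).
Variable R : idomainType.
Hypothesis R_pid : is_PID R.
Hypothesis R_fin : residue_finite R.

Lemma prime_dvd (p q : R) : prime_elt p -> prime_elt q -> rdvd p q ->
  assoc_class p = assoc_class q.
Proof.
move=> [p0 pu pp] [q0 qu qp] [c hq].
have [] := qp p c; first by exists 1; rewrite mulr1 -hq.
  move=> [d hd]; apply/assoc_classP; exists c => //.
  apply/unitrPr; exists d; apply: (mulfI p0).
  by rewrite mulrA -hq -hd mulr1.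
move=> [d hd]; case/negP: pu; apply/unitrPr; exists d.
by apply: (mulfI q0); rewrite mulr1 mulrCA -hd -hq.
Qed.

Lemma prime_classesP (p : set R) : prime_classes p ->
  prime_elt (xget 0 p) /\ assoc_class (xget 0 p) = p.
Proof.
move=> [a [a0 au ap] <-]; have [u uu h] := assoc_rep a; rewrite h; split; last first.
  by symmetry; apply/assoc_classP; exists u.
have E b : rdvd (a * u) b <-> rdvd a b.
  split=> [[c ->]|[c ->]]; first by exists (u * c); rewrite mulrA.
  by exists (u^-1 * c); rewrite -mulrA (mulrA u) mulrV // mul1r.
split; first by rewrite mulf_neq0 //; apply: contraTneq uu => ->; rewrite unitr0.
  by rewrite unitrM negb_and au.
by move=> b c /E/ap[] h'; [left | right]; apply/E.
Qed.

Definition coprime_classes (A : {fset set R}) : set (set R) :=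
  [set c | @nonzero_classes R c /\
     forall p, p \in A -> prime_classes p -> ~ rdvd (xget 0 p) (xget 0 c)].

Definition cofactor_class (x : R) (c : set R) : set R :=
  assoc_class (xget 0 [set q | xget 0 c = x * q]).

Lemma cofactor_classP (x : R) (c : set R) : rdvd x (xget 0 c) ->
  exists2 q, xget 0 c = x * q & cofactor_class x c = assoc_class q.
Proof.
move=> [q hq]; rewrite /cofactor_class; set a := xget 0 c in hq *.
by case: xgetP => [q' _ hq'|/(_ q)//]; exists q'; first exact: hq'.
Qed.

(** Multiplication by p is a bijection from the classes prime to A to those which are
    moreover divisible by p, because no other prime class divides p; it scales the terms
    by N(p)^(-s). *)
Lemma euler_factor (s : C) (A : {fset set R}) (p : set R) t : p \notin A -> prime_classes p ->
  has_sum (restr (coprime_classes A) (zeta_term s)) t ->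
  has_sum (restr (coprime_classes (p |` A)%fset) (zeta_term s))
    (t * (1 - npow (class_norm p) (- s))).
Proof.
move=> pA pp ht; have [P1 pE] := prime_classesP pp; have [p0 pu pprime] := P1.
set x := xget 0 p in P1 pE p0 pu pprime *.
pose D := [set c | coprime_classes A c /\ rdvd x (xget 0 c)].
pose phi (c : set R) := assoc_class (x * xget 0 c).
pose Fib (c : set R) := if c \in D then [fset cofactor_class x c]%fset else fset0.
have cof c : D c -> exists q, [/\ xget 0 c = x * q, cofactor_class x c = assoc_class q,
    q != 0 & coprime_classes A (assoc_class q)].
  move=> [[c0 hc] xc]; have [q hq qE] := cofactor_classP xc.
  have [c00 _] := nonzero_classesP c0.
  have q0 : q != 0 by apply: contra_neq c00 => q0; rewrite hq q0 mulr0.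
  exists q; split=> //; split; first by exists q.
  move=> r rA rp; have [u uu ->] := assoc_rep q => -[d hd].
  apply: (hc r rA rp); exists (x * d * u^-1); rewrite hq.
  have -> : q = xget 0 r * d * u^-1 by rewrite -hd mulrK.
  by rewrite !mulrA (mulrC x).
have h1 : has_sum (restr D (zeta_term s)) (npow (class_norm p) (- s) * t).
  apply: (@has_sum_fibres K _ _ phi Fib _ _ _ _ _ _ (has_sumZ _ ht)).
  - move=> i c; rewrite /Fib; case: ifP => //; rewrite in_setE => Dc.
    rewrite inE => /eqP ->; have [q [hq -> q0 _]] := cof c Dc.
    have [[c0 _] _] := Dc; have [_ cE] := nonzero_classesP c0.
    rewrite /phi -[RHS]cE; have [u uu ->] := assoc_rep q.
    rewrite mulrA -hq; symmetry; apply/assoc_classP; by exists u.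
  - move=> c h.
    have [Sc|Sc] := boolP (c \in coprime_classes A); last first.
      by move: h; rewrite /restr (negbTE Sc) mulr0 eqxx.
    move: Sc; rewrite in_setE => -[c0 hc]; have [c00 cE] := nonzero_classesP c0.
    have [u uu hu] := assoc_rep (x * xget 0 c).
    have Dphi : D (phi c).
      split; last by rewrite /phi hu -mulrA; exact: rdvd_mulr.
      split; first by exists (x * xget 0 c); rewrite //= mulf_neq0.
      move=> r rA rp; rewrite /phi hu.
      have [rprime rE] := prime_classesP rp; have [_ ru rpr] := rprime.
      move=> /rpr[/rpr[rx|/(hc r rA rp)//]|].
        case/negP: pA; rewrite -pE.
        have <- : assoc_class (xget 0 r) = assoc_class x by exact: prime_dvd.
        by rewrite rE.
      move=> [d hd]; case/negP: ru; apply/unitrPr; exists (d * u^-1).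
      by rewrite mulrA -hd mulrV.
    rewrite /Fib mem_set // inE; apply/eqP.
    have [q [hq -> _ _]] := cof _ Dphi.
    rewrite -{1}cE; apply/assoc_classP; exists u => //.
    by apply: (mulfI p0); rewrite -hq /phi hu mulrA.
  - move=> c; rewrite /Fib /restr; case: ifP; last by rewrite big_seq_fset0.
    rewrite in_setE big_seq_fset1 => Dc; have [q [hq -> q0 qS]] := cof c Dc.
    rewrite mem_set // /zeta_term class_norm_assoc.
    have -> : class_norm c = (class_norm p * absnorm q)%N.
      by rewrite /class_norm hq absnormM.
    by rewrite npowM // ?absnorm_gt0.
have := has_sumD ht (has_sumN h1); rewrite mulrBr mulr1 (mulrC t).
congr has_sum; apply/funext => c; rewrite /restr.
have [Sc|Sc] := boolP (c \in coprime_classes A); last first.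
  rewrite !memNset ?subr0 //.
    move=> [c0 h]; case/negP: Sc; rewrite in_setE; split=> // r rA.
    by apply: h; rewrite in_fset1U rA orbT.
  by move=> [/mem_set h _]; rewrite h in Sc.
have [xc|xc] := pselect (rdvd x (xget 0 c)).
  rewrite (mem_set (_ : D c)) ?subrr ?memNset //.
    by move=> [_ /(_ p)]; apply => //; rewrite in_fset1U eqxx.
  by split; rewrite // -in_setE.
rewrite (memNset (_ : ~ D c)) ?subr0; last by move=> [_].
rewrite mem_set //; move: Sc; rewrite in_setE => -[c0 hc]; split=> // r.
by rewrite in_fset1U => /orP[/eqP -> _ //|/hc].
Qed.

Lemma euler_partial (s z : C) (A : {fset set R}) : has_sum (@zeta_summand K R s) z ->
  has_sum (restr (coprime_classes A) (zeta_term s))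
    (z * \prod_(p <- A | p \in @prime_classes R) (1 - npow (class_norm p) (- s))).
Proof.
move=> hz; elim/finSet_rect: A => A IH.
have [->|/fset0Pn[p pA]] := eqVneq A fset0.
  rewrite big_mkcond big_seq_fset0 mulr1; move: hz; congr (has_sum (restr _ _)).
  apply/seteqP; split=> c; first by move=> ?; split.
  by move=> [].
have := IH (A `\ p)%fset (fproperD1 pA) => {}IH.
rewrite -(fsetD1K pA) big_mkcond big_fsetU1 ?in_fsetD1 ?eqxx //= -big_mkcond /=.
have [pp|pp] := boolP (p \in @prime_classes R).
  rewrite mulrCA mulrC; apply: euler_factor => //; first by rewrite in_fsetD1 eqxx.
  by rewrite -in_setE.
rewrite mul1r; move: IH; congr (has_sum (restr _ _)).
apply/seteqP; split=> c [c0 hc]; split=> // r.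
  by rewrite in_fset1U => /orP[/eqP -> /mem_set h|/hc //]; rewrite h in pp.
by move=> rA; apply: hc; rewrite in_fset1U rA orbT.
Qed.

(** A class other than that of the units consists of nonunits. *)
Lemma class_prime_divisor c : @nonzero_classes R c -> c != assoc_class 1 ->
  exists p, prime_classes p /\ rdvd (xget 0 p) (xget 0 c).
Proof.
move=> c0 c1; have [c00 cE] := nonzero_classesP c0.
have [cu|cu] := boolP (xget 0 c \is a GRing.unit).
  case/eqP: c1; rewrite -cE; apply/esym/assoc_classP; exists (xget 0 c) => //.
  by rewrite mul1r.
have [p pp pc] := prime_divisor R_fin R_pid c00 cu.
exists (assoc_class p); split; first by exists p.
have [u uu ->] := assoc_rep p; move: pc => [d ->].
by exists (u^-1 * d); rewrite mulrA mulrK.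
Qed.

(** Given a finite set of classes carrying all but e / 2 of the absolute sum, take A to
    contain a prime divisor of each of its members other than the unit class.  Then the
    classes prime to A are the unit class and classes of the small tail. *)
Lemma euler_limit (s z : C) M : abs_sums_le (@zeta_summand K R s) M ->
  has_sum (@zeta_summand K R s) z ->
  net_lim (fun A : {fset set R} => z *
    \prod_(p <- A | p \in @prime_classes R) (1 - npow (class_norm p) (- s))) 1.
Proof.
move=> hM hz e e0.
have e2 : 0 < e / 2 by rewrite divr_gt0.
have [A0 hA0] := sums_tail (fun c => cnorm_ge0 (@zeta_summand K R s c)) hM e2.
have [f hf] : exists f : set R -> set R, forall c, @nonzero_classes R c ->
    c != assoc_class 1 -> prime_classes (f c) /\ rdvd (xget 0 (f c)) (xget 0 c).
  have /choice[f hf] : forall c : set R, exists p, @nonzero_classes R c ->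
      c != assoc_class 1 -> prime_classes p /\ rdvd (xget 0 p) (xget 0 c).
    move=> c; have [h|h] := pselect (@nonzero_classes R c /\ c != assoc_class 1).
      by have [p hp] := class_prime_divisor h.1 h.2; exists p.
    by exists set0 => h1 h2; case: h.
  by exists f.
exists [fset f c | c in A0]%fset => B AB.
have hB := euler_partial B hz; set t := z * _ in hB *.
apply: (@le_lt_trans _ _ (e / 2)); last by lra.
pose g : set R -> C := restr [set assoc_class 1] (zeta_term s).
have g1 : g (assoc_class 1) = 1.
  by rewrite /g /restr mem_set // /zeta_term class_norm_assoc absnorm1 npow1.
have hg : has_sum g 1.
  rewrite -g1; apply: has_sum1 => c c1; rewrite /g /restr memNset // => /= h.
  by rewrite h eqxx in c1.
have := has_sumD hB (has_sumN hg) => /has_sum_le; apply; apply: sums_le_dom hA0 => c /=.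
have [->|c1] := eqVneq c (assoc_class 1).
  rewrite g1 /restr mem_set; last first.
    split; first by exists 1; rewrite //= oner_neq0.
    move=> p _ /prime_classesP[[_ pu _] _] [d hd].
    have [u uu hu] := assoc_rep (1 : R); rewrite hu mul1r in hd.
    by case/negP: pu; move: uu; rewrite hd unitrM => /andP[].
  rewrite /zeta_term class_norm_assoc absnorm1 npow1 subrr cnorm0.
  by case: ifP => // _; rewrite cnorm_ge0.
rewrite /g {2}/restr memNset ?subr0; last by move=> /= h; rewrite h eqxx in c1.
have [Sc|Sc] := boolP (c \in coprime_classes B); last first.
  by rewrite /restr (negbTE Sc) cnorm0; case: ifP => // _; rewrite cnorm_ge0.
have := Sc; rewrite in_setE => -[c0 hc].
rewrite ifF; first by rewrite /zeta_summand /restr Sc mem_set.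
apply/negP => cA; have [pp pd] := hf c c0 c1; apply: (hc (f c)) => //.
by apply: (fsubsetP AB); apply/imfsetP; exists c.
Qed.

(** The limit 1 of [euler_limit] forces z to be nonzero. *)
Lemma zeta_euler (s z : C) M : abs_sums_le (@zeta_summand K R s) M ->
  has_sum (@zeta_summand K R s) z ->
  z != 0 /\ net_lim (fun A : {fset set R} =>
    \prod_(p <- A | p \in @prime_classes R) (1 - npow (class_norm p) (- s))) z^-1.
Proof.
move=> hM hz; have h := euler_limit hM hz.
have z0 : z != 0.
  apply/eqP => z0; have h0 : @net_lim K (set R) (fun=> 0) 1.
    by move: h; congr net_lim; apply/funext => A; rewrite z0 mul0r.
  have /eqP := net_lim_unique h0 (@net_lim_cst K (set R) 0).
  by rewrite oner_eq0.
split=> //; have := net_limM (@net_lim_cst K (set R) z^-1) h; rewrite mulr1.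
by congr net_lim; apply/funext => A; rewrite mulKf.
Qed.

End Euler.

(** * The skew-growth series as the Dirichlet inverse of the growth series *)

Section DirichletNat.
Variable K : realType.
Local Notation C := (K[i]).
Local Notation cnorm := (@ComplexField.Normc.normc K).

(** The value at m = 0 is set to 0, since norms are positive while the logarithm of 0 is
    also 0. *)
Definition nat_term (x : nat -> C) (s : C) (m : nat) : C :=
  if m == 0%N then 0 else x m * npow m (- s).

(** The factorisations of m; these are the fibres of multiplication of positive
    integers. *)
Definition div_pairs (m : nat) : {fset nat * nat} :=
  if m is 0 then fset0 else [fset (d, (m %/ d)%N) | d in divisors m]%fset.

Lemma div_pairsP m p : p \in div_pairs m -> (p.1 * p.2)%N = m /\ (0 < m)%N.
Proof.
case: m => [|m] //= /imfsetP[d /= dm ->] /=; split=> //.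
by move: dm; rewrite -dvdn_divisors // => dm; rewrite mulnC divnK.
Qed.

Lemma mem_div_pairs (p : nat * nat) : (0 < p.1)%N -> (0 < p.2)%N ->
  p \in div_pairs (p.1 * p.2).
Proof.
case: p => d e /= d0 e0; rewrite /div_pairs.
have : (0 < d * e)%N by rewrite muln_gt0 d0.
case E : (d * e)%N => [|m] // _; apply/imfsetP; exists d => /=.
  by rewrite -dvdn_divisors // -E dvdn_mulr.
by rewrite -E mulKn.
Qed.

Lemma sum_div_pairs (V : nmodType) (F : nat * nat -> V) m :
  (0 < m)%N ->
  \sum_(p <- div_pairs m) F p = \sum_(d <- divisors m) F (d, (m %/ d)%N).
Proof.
case: m => // m _; rewrite /div_pairs big_imfset /=; last by move=> d e _ _ [].
apply: perm_big; apply: uniq_perm; rewrite ?divisors_uniq //; last first.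
  by move=> d; rewrite /= mem_undup.
exact: undup_uniq.
Qed.

Lemma nat_term_mul (x y : nat -> C) s m : (0 < m)%N ->
  \sum_(p <- div_pairs m) nat_term x s p.1 * nat_term y s p.2 =
  (\sum_(d <- divisors m) x d * y (m %/ d)%N) * npow m (- s).
Proof.
move=> m0; rewrite sum_div_pairs // mulr_suml; apply: eq_big_seq => d.
rewrite -dvdn_divisors //= => dm; have d0 := dvdn_gt0 m0 dm.
have e0 : (0 < m %/ d)%N by rewrite divn_gt0 // dvdn_leq.
have -> : npow m (- s) = npow (m %/ d) (- s) * npow d (- s) by rewrite -npowM // divnK.
by rewrite /nat_term !gtn_eqF //; ring.
Qed.

Definition below (N : nat) : {fset nat} := [fset i in iota 0 N]%fset.

Lemma in_below N i : (i \in below N) = (i < N)%N.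
Proof. by rewrite inE /= mem_iota. Qed.

Lemma sub_below (A : {fset nat}) : exists N, (A `<=` below N)%fset.
Proof.
exists (\max_(i <- A) i).+1; apply/fsubsetP => i iA; rewrite in_below ltnS.
exact: leq_bigmax_seq.
Qed.

(** Here u and w are the moduli of the terms of the inverse and of the non-constant part
    of a series.  The partial sum U of u up to N satisfies U <= 1 + U / 2, because the
    factorisations of the numbers below N lie in a square of side N. *)
Lemma inverse_bound (u w : nat -> K) :
  (forall m, 0 <= u m) -> (forall m, 0 <= w m) ->
  sums_le w 2^-1 ->
  (forall m, u m <= (m == 1%N)%:R + \sum_(p <- div_pairs m) u p.1 * w p.2) ->
  sums_le u 2.
Proof.
move=> u0 w0 hw hu A; have [N AN] := sub_below A.
apply: le_trans (sum_fset_le u0 AN) _.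
suff : \sum_(i <- below N) u i <= 1 + (\sum_(i <- below N) u i) * 2^-1 by lra.
apply: (@le_trans _ _ (\sum_(m <- below N)
   ((m == 1%N)%:R + \sum_(p <- div_pairs m) u p.1 * w p.2))).
  exact: ler_sum.
rewrite big_split; apply: lerD.
  rewrite -natr_sum -[leRHS]/(1%:R) ler_nat.
  have [iN|iN] := boolP (1%N \in below N).
    rewrite (big_fsetD1 1%N) //= big1_fset ?addn0 // => i.
    by rewrite in_fsetD1 => /andP[/negbTE ->].
  rewrite big1_fset // => i iB _; case: eqP => // i1; case/negP: iN; by rewrite -i1.
rewrite (@sum_fibres _ _ (fun p : nat * nat => (p.1 * p.2)%N)); last first.
  by move=> p m /div_pairsP[].
apply: (@le_trans _ _ (\sum_(p <- (below N `*` below N)%fset) u p.1 * w p.2)).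
  apply: sum_fset_le => [p|]; first by rewrite mulr_ge0.
  apply/fsubsetP => -[d e] /bigfcupP[m /andP[mN _] /div_pairsP[/= de m0]].
  rewrite in_fsetM /= !in_below.
  move: mN m0; rewrite in_below -de muln_gt0 => mN /andP[d0 e0].
  by apply/andP; split; apply: leq_ltn_trans mN; rewrite ?leq_pmulr ?leq_pmull.
by rewrite -sum_fsetM ler_wpM2l // sumr_ge0.
Qed.

End DirichletNat.

Section SkewGrowth.
Variable K : realType.
Local Notation C := (K[i]).
Local Notation cnorm := (@ComplexField.Normc.normc K).
Variable R : idomainType.
Hypothesis R_pid : is_PID R.
Hypothesis R_fin : residue_finite R.
Variable sigma_a : K.
Hypothesis zeta_cvg : forall s : C, sigma_a < complex.Re s ->
       abs_convergent (@nonzero_classes R) (zeta_term s).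

(** The Euler product is the inverse of the product of [zeta_euler]. *)
Lemma zeta_has_prod (s : C) : sigma_a < complex.Re s ->
  has_prod (@prime_classes R) (fun p => (1 - npow (class_norm p) (- s))^-1) (zeta R s).
Proof.
move=> hs; have [[M hM] hZ] := zeta_has_sum zeta_cvg hs.
have [z0 hE] := zeta_euler R_pid R_fin hM hZ.
apply/has_prodP; have := net_limV (invr_neq0 z0) hE; rewrite invrK.
by congr net_lim; apply/funext => A; rewrite prodfV.
Qed.

Variable n : nat.
Hypothesis n_gt0 : (0 < n)%N.

Lemma Re_subn (s : C) (k : nat) : complex.Re (s - k%:R) = complex.Re s - k%:R.
Proof. by rewrite raddfB /= -(rmorph_nat (real_complex K)). Qed.

Lemma in_strip (s : C) : sigma_a + n.-1%:R < complex.Re s ->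
  forall i : 'I_n, sigma_a < complex.Re (s - i%:R).
Proof.
move=> hs i; rewrite Re_subn ltrBrDr (le_lt_trans _ hs) // lerD2l ler_nat.
by rewrite -ltnS prednK.
Qed.

Local Notation cls m := (@classes_of_norm R n m).

(** Classes of the same norm contribute equal positive terms to a convergent series. *)
Lemma finite_classes_of_norm m : finite_set (cls m).
Proof.
have [|[M hM] _] := growth_has_sum R_pid R_fin zeta_cvg (s := (sigma_a + n.-1%:R + 1)%:C) (n := n).
  by apply: in_strip => /=; rewrite ltrDl.
apply: contrapT => /infinite_set_fset inf.
set s0 := (_ + 1)%:C in hM.
pose q := cnorm (npow m (- s0)).
have q0 : 0 < q by rewrite /q cnorm_npow expR_gt0.
have [B BS cB] := inf (Num.bound (M / q)).
have h1 : M / q < (#|` B|%fset)%:R.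
  apply: (@lt_le_trans _ _ (Num.bound (M / q))%:R); rewrite ?ler_nat //.
  by rewrite archi_boundP // divr_ge0 ?(ltW q0) // (sums_ge0 hM).
have := hM B; rewrite (eq_big_seq (fun=> q)); last first.
  move=> c cB'; have [h2 h3] := BS c cB'.
  by rewrite /= /class_summand /restr mem_set // h3.
rewrite big_const_seq count_predT iter_addr_0 -mulr_natl => h2.
by move: h1; rewrite ltr_pdivrMr // => /lt_le_trans/(_ h2); rewrite ltxx.
Qed.

Lemma class_mnorm_deg (c : set 'M[R]_n) : class_deg K c = ln (class_mnorm c)%:R.
Proof. by []. Qed.

Lemma ln_nat_inj (a b : nat) : (0 < a)%N -> (0 < b)%N ->
  ln (a%:R : K) = ln (b%:R : K) -> a = b.
Proof.
move=> a0 b0 h; apply/eqP; rewrite -(eqr_nat K); apply/eqP.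
by apply: ln_inj => //; rewrite posrE ltr0n.
Qed.

Lemma ln_nat_ge0 (a : nat) : 0 <= ln (a%:R : K).
Proof. by case: a => [|a]; [rewrite ln0 | rewrite ln_ge0 ?ler1n]. Qed.

Definition classes_of_deg (r : K) := [set c | @lclasses R n c /\ class_deg K c = r].

Lemma finite_classes_of_deg r : finite_set (classes_of_deg r).
Proof.
have [->|/set0P[c [cC cr]]] := eqVneq (classes_of_deg r) set0; first exact: finite_set0.
apply: sub_finite_set (finite_classes_of_norm (class_mnorm c)) => d [dC dr]; split=> //.
apply: ln_nat_inj; [exact: (class_mnorm_gt0 R_fin) | exact: (class_mnorm_gt0 R_fin) | ].
by rewrite -!class_mnorm_deg cr.
Qed.

Lemma dirichlet_npow (x : K -> C) s (m : nat) :
  dirichlet_term x s (ln m%:R) = x (ln m%:R) * npow m (- s).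
Proof. by []. Qed.

Lemma growth_dirichlet (s : C) : sigma_a + n.-1%:R < complex.Re s ->
  (exists M, abs_sums_le (dirichlet_term (@Pcoef K R n) s) M) /\
  has_sum (dirichlet_term (@Pcoef K R n) s) (\prod_(i < n) zeta R (s - i%:R)).
Proof.
move=> /in_strip /(growth_has_sum R_pid R_fin zeta_cvg)[[M hM] hP].
have FibP c r : c \in fset_set (classes_of_deg r) -> class_deg K c = r.
  by rewrite in_fset_set ?in_setE; [case | exact: finite_classes_of_deg].
have supp (c : set 'M[R]_n) : class_summand s c != 0 -> c \in fset_set (classes_of_deg (class_deg K c)).
  rewrite /class_summand /restr; case: ifP; rewrite ?eqxx // in_setE => h _.
  by rewrite in_fset_set ?in_setE //; exact: finite_classes_of_deg.
have hE r : dirichlet_term (@Pcoef K R n) s r =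
    \sum_(c <- fset_set (classes_of_deg r)) class_summand s c.
  rewrite (eq_big_seq (fun=> cexp (- s * r%:C))); last first.
    move=> c; rewrite in_fset_set ?in_setE; last exact: finite_classes_of_deg.
    by move=> [cC <-]; rewrite /class_summand /restr mem_set.
  by rewrite big_const_seq count_predT iter_addr_0 -mulr_natl.
split; last exact: (has_sum_fibres FibP supp hE hP).
exists M; apply: (sums_le_fibres FibP _ hM) => r /=.
by rewrite hE; exact: cnorm_sum.
Qed.

Lemma Pcoef_neg r : r < 0 -> @Pcoef K R n r = 0.
Proof.
move=> r0; rewrite /Pcoef /growth_coef (_ : [set c | _] = set0) ?fset_set0 //.
apply/seteqP; split=> c //= [_ cr]; move: r0.
by rewrite -cr class_mnorm_deg ltNge ln_nat_ge0.
Qed.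

Definition growth_term := nat_term (fun m => (num_classes R n m)%:R : C).
Definition skew_term := nat_term (fun m => (sign_sum R n m)%:~R : C).

Lemma growth_nat (s : C) : sigma_a + n.-1%:R < complex.Re s ->
  (exists M, abs_sums_le (growth_term s) M) /\ has_sum (growth_term s) (\prod_(i < n) zeta R (s - i%:R)).
Proof.
move=> /in_strip /(growth_has_sum R_pid R_fin zeta_cvg)[[M hM] hP].
have FibP (c : set 'M[R]_n) m : c \in fset_set (cls m) -> class_mnorm c = m.
  by rewrite in_fset_set ?in_setE; [case | exact: finite_classes_of_norm].
have supp (c : set 'M[R]_n) : class_summand s c != 0 -> c \in fset_set (cls (class_mnorm c)).
  rewrite /class_summand /restr; case: ifP; rewrite ?eqxx // in_setE => h _.
  by rewrite in_fset_set ?in_setE //; exact: finite_classes_of_norm.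
have hE m : growth_term s m = \sum_(c <- fset_set (cls m)) class_summand s c.
  rewrite (eq_big_seq (fun=> npow m (- s))); last first.
    move=> c; rewrite in_fset_set ?in_setE; last exact: finite_classes_of_norm.
    by move=> [cC <-]; rewrite /class_summand /restr mem_set.
  rewrite big_const_seq count_predT iter_addr_0 -mulr_natl /growth_term /nat_term /num_classes.
  case: eqP => // ->; rewrite (_ : cls 0 = set0) ?fset_set0 ?mul0r //.
  by apply/seteqP; split=> c //= [/(class_mnorm_gt0 R_fin) h c0]; rewrite c0 in h.
split; last exact: (has_sum_fibres FibP supp hE hP).
exists M; apply: (sums_le_fibres FibP _ hM) => m /=.
by rewrite hE; exact: cnorm_sum.
Qed.

Lemma num_classes1 : num_classes R n 1 = 1%N.
Proof.
have := duality R_pid R_fin finite_classes_of_norm (ltn0Sn 0).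
rewrite /= big_seq1 divn1 => /(congr1 absz); rewrite abszM.
by move=> /eqP; rewrite muln_eq1 => /andP[_ /eqP]; rewrite natz.
Qed.

Lemma dualityC m : (0 < m)%N ->
  \sum_(d <- divisors m) (sign_sum R n d)%:~R * (num_classes R n (m %/ d))%:R =
  (m == 1%N)%:R :> C.
Proof.
move=> m0; have := congr1 (fun z : int => z%:~R : C) (duality R_pid R_fin finite_classes_of_norm m0).
rewrite /= rmorph_sum /= mulrz_nat => <-.
by apply: eq_bigr => d _; rewrite rmorphM /= mulrz_nat.
Qed.

(** [duality] for the terms at s: the product of the two series has constant term 1 and
    no other. *)
Lemma convolution_one s m :
  \sum_(p <- div_pairs m) skew_term s p.1 * growth_term s p.2 = (m == 1%N)%:R.
Proof.
case: m => [|m]; first by rewrite big_seq_fset0.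
rewrite nat_term_mul // dualityC //; case: eqP => [->|]; rewrite ?mul0r //.
by rewrite npow1 mul1r.
Qed.

Lemma cnorm_nat_term_mono (x : nat -> C) (s t : C) m : complex.Re s <= complex.Re t ->
  cnorm (nat_term x t m) <= cnorm (nat_term x s m).
Proof.
move=> st; rewrite /nat_term; case: eqP => // _; rewrite 2!(cnormM (x m)) !cnorm_npow.
rewrite ler_wpM2l ?cnorm_ge0 // ler_expR !raddfN /= ler_wpM2r ?ln_nat_ge0 //.
by rewrite lerN2.
Qed.

(** Moving s to the right by k divides the non-constant terms of the growth series by at
    least 2^k.  Once their sum is at most 1/2, [inverse_bound] applies to the recursion
    obtained by solving [convolution_one] for the term of index m. *)
Lemma skew_term_abs : exists sigma : K, sigma_a + n.-1%:R < sigma /\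
  forall s : C, sigma <= complex.Re s -> abs_sums_le (skew_term s) 2.
Proof.
pose s0 : K := sigma_a + n.-1%:R + 1.
have [|[M hM] _] := growth_nat (s := s0%:C); first by rewrite /= ltrDl.
have M0 := sums_ge0 hM.
pose k := (Num.bound M).+1.
have Mk : M / 2 ^+ k <= 2^-1.
  rewrite ler_pdivrMr ?exprn_gt0 // /k exprS mulKf ?pnatr_eq0 // ltW //.
  exact: upper_nthrootP.
exists (s0 + k%:R); split; first by rewrite -addrA ltrDl ltr_pwDl.
pose S : C := (s0 + k%:R)%:C.
suff H : abs_sums_le (skew_term S) 2.
  by move=> s hs; apply: sums_le_dom H => m; exact: cnorm_nat_term_mono.
pose w m := if (m <= 1)%N then 0 else cnorm (growth_term S m).
apply: (@inverse_bound _ _ w).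
- by move=> m; exact: cnorm_ge0.
- by move=> m; rewrite /w; case: ifP => // _; exact: cnorm_ge0.
- move=> A; apply: le_trans Mk; rewrite ler_pdivlMr ?exprn_gt0 // mulr_suml.
  apply: le_trans (hM A); apply: ler_sum => m _; rewrite /w /=.
  case: leqP => m1; first by rewrite mul0r cnorm_ge0.
  rewrite /growth_term /nat_term gtn_eqF ?(ltn_trans _ m1) // 2!(cnormM (_%:R)) -mulrA.
  rewrite ler_wpM2l ?cnorm_ge0 //.
  rewrite /S rmorphD opprD npowD (cnormM (npow _ _)) -mulrA ler_piMr ?cnorm_ge0 //.
  have m0 : (0 < m)%N by apply: ltn_trans m1.
  have : cnorm (npow m (- (k%:R%:C : C))) * (m%:R ^+ k) = 1.
    have -> : (m%:R ^+ k : K) = cnorm (npow m (k%:R : C)).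
      by rewrite npow_nat // cnorm_natr natrX.
    rewrite -cnormM -npowD rmorph_nat addNr /npow mul0r cexp0 cnorm1 //.
  move=> E; rewrite -[leRHS]E ler_wpM2l ?cnorm_ge0 // lerXn2r ?nnegrE ?ler0n //.
  by rewrite ler_nat.
move=> m; rewrite /=.
case: m => [|m]; first by rewrite /skew_term /nat_term eqxx cnorm0 big_seq_fset0 addr0.
have := convolution_one S m.+1; rewrite !sum_div_pairs //.
have mm : m.+1 \in divisors m.+1 by rewrite -dvdn_divisors.
have a1 : growth_term S 1 = 1 by rewrite /growth_term /nat_term num_classes1 npow1 mulr1.
rewrite (bigD1_seq m.+1) ?divisors_uniq //= divnn /= a1 mulr1.
move=> /(canRL (addrK _)) ->.
rewrite (le_trans (cnormD _ _)) // cnormN cnorm_natr lerD2l.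
rewrite big_mkcond /= (le_trans (cnorm_sum _ _)) //.
rewrite big_seq [leRHS]big_seq; apply: ler_sum => d.
rewrite -dvdn_divisors // => dm.
have w0 : 0 <= w (m.+1 %/ d)%N by rewrite /w; case: ifP => // _; exact: cnorm_ge0.
case: ifP => dm1; last by rewrite cnorm0 mulr_ge0 ?cnorm_ge0.
rewrite cnormM ler_wpM2l ?cnorm_ge0 // /w ifF // leqNgt.
apply/negbF; have d0 := dvdn_gt0 (ltn0Sn m) dm.
rewrite ltn_divRL // mul1n ltn_neqAle dm1; exact: dvdn_leq.
Qed.

(** ** From integral norms to real exponents *)

Lemma class_mnorm_LCM_gt0 (J : {fset set 'M[R]_n}) : [set` J] `<=` @I0 R n ->
  (0 < class_mnorm (LCM [set` J]))%N.
Proof.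
move=> JI; have [|L [L0 -> _]] := LCM_exists R_pid R_fin (J := J).
  by move=> c /JI/I0_lclasses.
by apply: (class_mnorm_gt0 R_fin); exists L.
Qed.

Lemma skew_growth_coef_ln m : (0 < m)%N ->
  skew_growth_coef R n (ln (m%:R : K)) = sign_sum R n m.
Proof.
move=> m0; rewrite /skew_growth_coef /sign_sum.
congr (\sum_(J \in _) _); apply/seteqP; split=> J [JI h]; split=> //.
  by apply: ln_nat_inj => //; exact: class_mnorm_LCM_gt0.
by rewrite class_mnorm_deg h.
Qed.

(** Exponents which are not logarithms of positive integers do not occur. *)
Lemma skew_growth_coef_out (r : K) : (forall m, (0 < m)%N -> ln m%:R != r) ->
  skew_growth_coef R n r = 0.
Proof.
move=> h; rewrite /skew_growth_coef (_ : [set J | _] = set0) ?fsbig_set0 //.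
apply/seteqP; split=> J //= [JI Jr].
by have := h _ (class_mnorm_LCM_gt0 JI); rewrite -Jr class_mnorm_deg eqxx.
Qed.

(** The positive integers with logarithm r: at most one. *)
Definition exponent_fibre (r : K) : {fset nat} :=
  if `[< exists2 m, (0 < m)%N & ln m%:R = r >] then
    [fset xget 0%N [set m | (0 < m)%N /\ ln m%:R = r]]%fset else fset0.

Lemma exponent_fibreP r m : m \in exponent_fibre r <-> (0 < m)%N /\ ln m%:R = r.
Proof.
rewrite /exponent_fibre; case: asboolP => [[k k0 kr]|h]; last first.
  by split=> // -[m0 mr]; case: h; exists m.
rewrite inE; case: xgetP => [a _ [a0 ar]|/(_ k)[]]; last by split.
split=> [/eqP -> //|[m0 mr]]; apply/eqP; apply: ln_nat_inj => //.
by rewrite mr.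
Qed.

Lemma skew_growth_coef_term s r :
  dirichlet_term (@Ncoef K R n) s r = \sum_(m <- exponent_fibre r) skew_term s m.
Proof.
have [[m [m0 mr]]|h] := pselect (exists m, (0 < m)%N /\ ln m%:R = r).
  rewrite (_ : exponent_fibre r = [fset m]%fset) ?big_seq_fset1; last first.
    apply/fsetP => k; rewrite inE; apply/idP/eqP => [/exponent_fibreP[k0 kr]|->].
      by apply: ln_nat_inj => //; rewrite mr.
    exact/exponent_fibreP.
  by rewrite -mr dirichlet_npow /skew_term /nat_term gtn_eqF // /Ncoef skew_growth_coef_ln.
rewrite (_ : exponent_fibre r = fset0) ?big_seq_fset0; last first.
  by apply/fsetP => k; rewrite inE; apply/negP => /exponent_fibreP hk; apply: h; exists k.
rewrite /dirichlet_term /Ncoef skew_growth_coef_out ?mul0r // => m m0.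
by apply/eqP => mr; apply: h; exists m.
Qed.

Lemma skew_growth_dirichlet s l : abs_sums_le (skew_term s) 2 -> has_sum (skew_term s) l ->
  abs_sums_le (dirichlet_term (@Ncoef K R n) s) 2 /\
  has_sum (dirichlet_term (@Ncoef K R n) s) l.
Proof.
move=> hM hl; pose phi (m : nat) : K := ln m%:R.
have FibP m r : m \in exponent_fibre r -> phi m = r by move=> /exponent_fibreP[].
split; last first.
  apply: (has_sum_fibres FibP _ (skew_growth_coef_term s) hl) => m.
  rewrite /skew_term /nat_term; case: (m =P 0%N) => [_|/eqP m0 _]; first by rewrite eqxx.
  by apply/exponent_fibreP; rewrite lt0n.
apply: (sums_le_fibres FibP _ hM) => r /=.
by rewrite skew_growth_coef_term; exact: cnorm_sum.
Qed.

Lemma Ncoef_neg r : r < 0 -> @Ncoef K R n r = 0.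
Proof.
move=> r0; rewrite /Ncoef skew_growth_coef_out // => m m0; apply/eqP => mr.
by move: r0; rewrite -mr ltNge ln_nat_ge0.
Qed.

(** The product of the two series, regrouped along multiplication of indices. *)
Lemma growth_skew_growth s l : sigma_a + n.-1%:R < complex.Re s ->
  abs_sums_le (skew_term s) 2 -> has_sum (skew_term s) l ->
  l * (\prod_(i < n) zeta R (s - i%:R)) = 1.
Proof.
move=> hs hb hl; have [[M hM] hP] := growth_nat hs.
have h := has_sumM hb hM hl hP.
have h1 : has_sum (fun m : nat => (m == 1%N)%:R : C) 1.
  by apply: (@has_sum1 K _ (fun m : nat => (m == 1%N)%:R : C) 1%N) => m /negbTE ->.
apply: has_sum_unique _ h1.
apply: (@has_sum_fibres K _ _ (fun p : nat * nat => (p.1 * p.2)%N) div_pairs _ _ _ _ _ _ h).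
- by move=> p m /div_pairsP[].
- move=> p; rewrite mulf_eq0 negb_or => /andP[h1' h2'].
  apply: mem_div_pairs; rewrite lt0n.
    by move: h1'; rewrite /skew_term /nat_term; case: (p.1 =P 0%N); rewrite ?eqxx.
  by move: h2'; rewrite /growth_term /nat_term; case: (p.2 =P 0%N); rewrite ?eqxx.
- by move=> m; rewrite convolution_one.
Qed.

End SkewGrowth.

Theorem mainTheorem3 (K : realType) (R : idomainType) (n : nat)
    (R_pid : is_PID R) (R_fin : residue_finite R) (n_gt0 : (0 < n)%N)
    (sigma_a : K)
    (zeta_cvg : forall s : K[i], sigma_a < complex.Re s ->
       abs_convergent (@nonzero_classes R) (zeta_term s)) :
  (forall s : K[i], sigma_a < complex.Re s ->
     has_prod (@prime_classes R) (fun p => (1 - npow (class_norm p) (- s))^-1)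
       (zeta R s)) /\
  exists sigma : K, sigma_a + (n.-1)%:R <= sigma /\
    forall s : K[i], sigma < complex.Re s ->
      ([/\ abs_convergent setT (dirichlet_term (@Pcoef K R n) s),
           derivable (dirichlet (@Pcoef K R n) : K[i]^o -> K[i]^o) s 1
         & dirichlet (@Pcoef K R n) s = \prod_(i < n) zeta R (s - i%:R)]) /\
      ([/\ abs_convergent setT (dirichlet_term (@Ncoef K R n) s),
           derivable (dirichlet (@Ncoef K R n) : K[i]^o -> K[i]^o) s 1
         & has_prod (@prime_classes R)
             (fun p => \prod_(i < n) (1 - npow (class_norm p) (- s + i%:R)))
             (dirichlet (@Ncoef K R n) s)]).
Proof.
split; first by move=> s; exact: zeta_has_prod.
have [sigma [hsig hb]] := skew_term_abs R_pid R_fin zeta_cvg n_gt0.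
exists sigma; split; first exact: ltW.
move=> s hs; have hs' := lt_trans hsig hs.
split.
  have [[M hM] hP] := growth_dirichlet R_pid R_fin zeta_cvg n_gt0 hs'.
  split.
  - by apply/abs_convergentP; exists M; rewrite restrT.
  - have [[M' hM'] _] := growth_dirichlet R_pid R_fin zeta_cvg n_gt0 (s := sigma%:C) hsig.
    exact: dirichlet_derivable (@Pcoef_neg _ _ _) hM' hs.
  - by apply: sum_over_eq; rewrite restrT.
have [l hl] := has_sum_abs (hb s (ltW hs)).
have [hA hN] := skew_growth_dirichlet R_pid R_fin (hb s (ltW hs)) hl.
have hl1 := growth_skew_growth R_pid R_fin zeta_cvg n_gt0 hs' (hb s (ltW hs)) hl.
split.
- by apply/abs_convergentP; exists 2; rewrite restrT.
- have [l0 hl0] := has_sum_abs (hb sigma%:C (lexx _)).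
  have [hA0 _] := skew_growth_dirichlet R_pid R_fin (hb sigma%:C (lexx _)) hl0.
  exact: dirichlet_derivable (@Ncoef_neg _ _ R_pid R_fin _) hA0 hs.
have -> : dirichlet (@Ncoef K R n) s = \prod_(i < n) (zeta R (s - i%:R))^-1.
  rewrite (_ : dirichlet _ _ = l); last by apply: sum_over_eq; rewrite restrT.
  rewrite prodfV; apply: (@mulIf _ (\prod_(i < n) zeta R (s - i%:R))).
    by apply/eqP => h0; move: hl1; rewrite h0 mulr0 => /eqP; rewrite eq_sym oner_eq0.
  rewrite hl1 mulVf //.
  by apply/eqP => h0; move: hl1; rewrite h0 mulr0 => /eqP; rewrite eq_sym oner_eq0.
apply/has_prodP.
have E (i : 'I_n) : net_lim (fun A : {fset set R} => \prod_(p <- A | p \in @prime_classes R)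
    (1 - npow (class_norm p) (- s + i%:R))) (zeta R (s - i%:R))^-1.
  have [[M hM] hZ] := zeta_has_sum zeta_cvg (in_strip n_gt0 hs' i).
  have [_] := zeta_euler R_pid R_fin hM hZ.
  by congr net_lim; apply/funext => A; apply: eq_bigr => p _; rewrite opprD opprK.
have := net_lim_prod (index_enum 'I_n) E.
by congr net_lim; apply/funext => A; rewrite exchange_big.
Qed.
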